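(* Let $d\ge1$ and let $\mathcal{P}$ be a finite set of punctured tiles in $\mathbb{R}^d$ with finite local complexity and $\Omega_\circ(\mathcal{P})\neq\varnothing$. For all integers $K\ge117$ and $L\ge2K+14$, the map $\Psi$ (defined in the context) is a homeomorphism between $\Omega_\circ(\mathcal{P})$ and the space of models $\mathcal{M}(\Gamma(\mathcal{P},K,L))$ of the patch blueprint.
   Context: **Blueprints and models.** A blueprint $\Gamma=(M,S,\mathfrak{i},\mathfrak{t},R)$ consists of a nonempty set $M$ of states (with $\varnothing\notin M$), a nonempty set $S$ of generators, maps $\mathfrak{i}\colon S\to M$ and $\mathfrak{t}\colon S\to\mathcal{P}(M)\setminus\{\varnothing\}$ (power set of $M$), and a set $R\subseteq S^*\times S^*$ of relations ($S^*$ is the set of finite words, $\varepsilon$ the empty word). For a nonempty word, $\mathfrak{i}(w_1\cdots w_n)=\mathfrak{i}(w_1)$. A word $w_1\cdots w_n$ is $\Gamma$-consistent if it is empty or $\mathfrak{i}(w_{i+1})\in\mathfrak{t}(w_i)$ for $1\le i<n$. Two $\Gamma$-consistent words $u,v$ are $\Gamma$-similar if $u=xwy$, $v=xw'y$ for some $(w,w')\in R$, $x,y\in S^*$; $\Gamma$-equivalence is the equivalence relation on $\Gamma$-consistent words generated by $\Gamma$-similarity. A map $\varphi\colon S^*\to M\cup\{\varnothing\}$ is $\Gamma$-consistent if $\varphi(\varepsilon)\in M$ and for all $w\in S^*$, $s\in S$: $\mathfrak{i}(s)=\varphi(w)$ implies $\varphi(ws)\in\mathfrak{t}(s)$, and $\mathfrak{i}(s)\ne\varphi(w)$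 implies $\varphi(ws)=\varnothing$. $\operatorname{supp}(\varphi)=\{w:\varphi(w)\ne\varnothing\}$. A $\Gamma$-model is a $\Gamma$-consistent $\varphi$ with $\varphi(u)=\varphi(v)$ for all $\Gamma$-equivalent $u,v\in\operatorname{supp}(\varphi)$. $\mathcal{M}(\Gamma)\subset(M\cup\{\varnothing\})^{S^*}$ is the set of models with the topology induced by the prodiscrete topology. **Tilings.** Work in $\mathbb{R}^d$ with the Euclidean norm; $B_r(x)$ is the closed ball of radius $r$ centered at $x$, $B_r=B_r(0)$. A tile is a subset of $\mathbb{R}^d$ homeomorphic to the closed unit ball. A partial tiling is a collection of tiles with pairwise disjoint interiors; it is a tiling if its union is $\mathbb{R}^d$. For $P$ a partial tiling and $F\subseteq\mathbb{R}^d$, $P\sqcap F=\{t\in P:t\cap F\ne\varnothing\}$; $P_1,P_2$ match in $F$ if $P_1\sqcap F=P_2\sqcap F$; $P+x=\{t+x:t\in P\}$. A set of punctured tiles is a collection $\mathcal{P}=\{p_1,\dots,p_n\}$ of tiles with $0\in\operatorname{int}(p_i)$ and such that $p_i=v+p_j$ implies $i=j$, $v=0$. $\Omega(\mathcal{P})$ is the set of tilings all of whose tiles have the form $t=\operatorname{pos}(t)+p$ with $p\in\mathcal{P}$, $\operatorname{pos}(t)\in\mathbb{R}^d$ (both uniquely determined by $t$). $\Omega_\circ(\mathcal{P})$ is the set of $T\in\Omega(\mathcal{P})$ having a tile with $\operatorname{pos}(t)=0$. $\mathcal{P}$ has finite local complexity if $\{T\sqcap B_r:T\in\Omega_\circ(\mathcal{P})\}$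 is finite for all $r>0$. $\Omega_\circ(\mathcal{P})$ is metrized by $d(T_1,T_2)=2^{-\sup\{r\ge0:\,T_1\sqcap B_r=T_2\sqcap B_r\}}$. **Patch blueprint.** Let $\rho=\inf\{r>0:p\subset B_r\text{ for all }p\in\mathcal{P}\}$ and let $K,L$ be positive integers. $\Gamma(\mathcal{P},K,L)=(M,S,\mathfrak{i},\mathfrak{t},R)$ where $M=\{T\sqcap B_{K\rho}:T\in\Omega_\circ(\mathcal{P})\}$; $S=\{(m,v)\in M\times\mathbb{R}^d:0<\|v\|\le3\rho\text{ and }v=\operatorname{pos}(t)\text{ for some }t\in m\}$; for $s=(m,v)$: $\mathfrak{i}(s)=m$, $\operatorname{val}(s)=v$, and $\mathfrak{t}(s)=\{m'\in M:m'+\operatorname{val}(s)\text{ matches }m\text{ in }B_{K\rho}(0)\cap B_{K\rho}(\operatorname{val}(s))\}$; $\operatorname{val}(\varepsilon)=0$, $\operatorname{val}(s_1\cdots s_n)=\sum_i\operatorname{val}(s_i)$; $R=\{(w,w')\in S^*\times S^*:|w|+|w'|\le L,\ \mathfrak{i}(w)=\mathfrak{i}(w'),\ \operatorname{val}(w)=\operatorname{val}(w')\}$. **The map $\Psi$.** $\Psi\colon\Omega_\circ(\mathcal{P})\to(M\cup\{\varnothing\})^{S^*}$ is defined inductively by $\Psi(T)(\varepsilon)=T\sqcap B_{K\rho}$ and, for $w\in S^*$, $s\in S$: if $\Psi(T)(w)\neq\varnothing$, $\mathfrak{i}(s)=\Psi(T)(w)$ and $T-\operatorname{val}(ws)\in\Omega_\circ(\mathcal{P})$,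 then $\Psi(T)(ws)=(T-\operatorname{val}(ws))\sqcap B_{K\rho}$; otherwise $\Psi(T)(ws)=\varnothing$. *)

(* Defs.v *)
From HB Require Import structures.
From mathcomp Require Import all_boot all_order all_algebra.
From mathcomp Require Import all_classical all_reals all_analysis.
From mathcomp Require Import ring lra.
From Stdlib Require Import Relation_Operators.
Set Implicit Arguments.
Unset Strict Implicit.
Unset Printing Implicit Defensive.
Import Order.TTheory GRing.Theory Num.Theory.
Import numFieldNormedType.Exports.
Local Open Scope classical_set_scope.
Local Open Scope ring_scope.

Definition homeomorphism (X Y : topologicalType) (f : X -> Y) : Prop :=
  exists g : Y -> X, [/\ cancel f g, cancel g f, continuous f & continuous g].

(* [f] corestricts to a homeomorphism onto [A], where [A] has the topology
   induced by [Y]. *)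
Definition homeomorphism_onto (X Y : topologicalType) (f : X -> Y)
    (A : set Y) : Prop :=
  exists2 h : X -> set_type A,
    (forall x, set_val (h x) = f x) & homeomorphism h.

Record blueprint := Blueprint {
  state : choiceType;
  gen : Type;
  init : gen -> state;
  term : gen -> set state;
  rels : set (seq gen * seq gen);
  state_nonempty : [set: state] !=set0;
  gen_nonempty : [set: gen] !=set0;
  term_nonempty : forall s, term s !=set0 }.

Section models.
Variable G : blueprint.
Notation word := (seq (gen G)).

Fixpoint consistent (w : word) : Prop :=
  if w is s :: w' then
    (if w' is s' :: _ then term s (init s') else True) /\ consistent w'
  else True.

Definition similar (u v : word) : Prop :=
  [/\ consistent u, consistent v &
    exists x y w w', [/\ rels (w, w'), u = x ++ w ++ y & v = x ++ w' ++ y]].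

Definition equivalent (u v : word) : Prop :=
  [/\ consistent u, consistent v & clos_refl_sym_trans word similar u v].

(* The additional symbol for the empty set is [None]. *)
Definition consistent_map (phi : word -> option (state G)) : Prop :=
  phi [::] <> None /\
  forall w s,
    (phi w = Some (init s) ->
      exists2 m, phi (rcons w s) = Some m & term s m) /\
    (phi w <> Some (init s) -> phi (rcons w s) = None).

Definition supp (phi : word -> option (state G)) : set word :=
  [set w | phi w <> None].

Definition configurations : topologicalType :=
  {ptws word -> discrete_topology (option (state G))}.

Definition models : set configurations :=
  [set phi : word -> option (state G) | consistent_map phi /\
    forall u v, supp phi u -> supp phi v -> equivalent u v -> phi u = phi v].

End models.

Section tilings.
Variables (R : realType) (d : nat).
Notation E := ('rV[R]_d).

(* Not the norm of ['rV[R]_d], which is the sup norm; the topology is the same. *)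
Definition enorm (x : E) : R := Num.sqrt (\sum_(i < d) x ord0 i ^+ 2).

Definition cball (x : E) (r : R) : set E := [set y | enorm (y - x) <= r].

Definition is_tile (t : set E) : Prop :=
  exists f : set_type (cball 0 1) -> set_type t, homeomorphism f.

Definition partial_tiling (P : set (set E)) : Prop :=
  (forall t, P t -> is_tile t) /\
  (forall t t', P t -> P t' -> t <> t' -> interior t `&` interior t' = set0).

Definition tiling (T : set (set E)) : Prop :=
  partial_tiling T /\ \bigcup_(t in T) t = setT.

Definition meet_patch (P : set (set E)) (F : set E) : set (set E) :=
  [set t | P t /\ t `&` F !=set0].

Definition match_in (F : set E) (P1 P2 : set (set E)) : Prop :=
  meet_patch P1 F = meet_patch P2 F.

Definition translate (t : set E) (x : E) : set E := [set y + x | y in t].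

Definition translate_tiles (P : set (set E)) (x : E) : set (set E) :=
  [set translate t x | t in P].

Definition punctured_tiles (P : set (set E)) : Prop :=
  [/\ finite_set P,
      forall p, P p -> is_tile p /\ interior p 0 &
      forall p q v, P p -> P q -> p = translate q v -> p = q /\ v = 0].

Variable P : set (set E).

Definition pos_spec (t : set E) (v : E) : Prop :=
  exists2 p, P p & t = translate p v.

(* Meaningful only for translates of the tiles in [P]. *)
Definition pos (t : set E) : E := xget 0 [set v | pos_spec t v].

Definition Omega : set (set (set E)) :=
  [set T | tiling T /\ forall t, T t -> exists v, pos_spec t v].

Definition Omega_o : set (set (set E)) :=
  [set T | Omega T /\ exists2 t, T t & pos t = 0].

Definition finite_local_complexity : Prop :=
  forall r : R, 0 < r ->
    finite_set [set meet_patch T (cball 0 r) | T in Omega_o].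

Definition tiling_space : Type := set_type Omega_o.

Definition agreement_radii (T1 T2 : set (set E)) : set R :=
  [set r | 0 <= r /\ match_in (cball 0 r) T1 T2].

(* The supremum is taken in [0, +oo]: it is 0 if no radius works. *)
Definition agreement (T1 T2 : set (set E)) : \bar R :=
  maxe 0%E (ereal_sup [set r%:E | r in agreement_radii T1 T2]).

Definition tdist (T1 T2 : set (set E)) : R :=
  if agreement T1 T2 is r%:E then 2 `^ (- r) else 0.

Definition rho : R :=
  inf [set r : R | 0 < r /\ forall p, P p -> p `<=` cball 0 r].

Variable K : nat.

Definition patch_ball (x : E) : set E := cball x (K%:R * rho).

Definition patch_states : set (set (set E)) :=
  [set meet_patch T (patch_ball 0) | T in Omega_o].

Definition patch_gens : set (set_type patch_states * E) :=
  [set s | 0 < enorm s.2 <= 3 * rho /\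
           exists2 t, set_val s.1 t & s.2 = pos t].

Definition patch_init (s : patch_gens) : patch_states := (set_val s).1.

Definition gval (s : patch_gens) : E := (set_val s).2.

Definition patch_term (s : patch_gens) : set patch_states :=
  [set m' | match_in (patch_ball 0 `&` patch_ball (gval s))
              (translate_tiles (set_val m') (gval s))
              (set_val (patch_init s))].

Definition wval (w : seq patch_gens) : E := \sum_(s <- w) gval s.

(* The empty word has no initial state, so [patch_rels] relates it to no
   nonempty word. *)
Definition winit (w : seq patch_gens) : option patch_states :=
  ohead (map patch_init w).

Definition patch_rels (L : nat) : set (seq patch_gens * seq patch_gens) :=
  [set ww | [/\ (size ww.1 + size ww.2 <= L)%N, winit ww.1 = winit ww.2 &
                wval ww.1 = wval ww.2]].

(* [insub] is defined at the patch of any element of [Omega_o]. *)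
Definition patch_at (T : set (set E)) : option patch_states :=
  insub (meet_patch T (patch_ball 0)).

(* Recursion on the reversed word, since words grow to the right. *)
Fixpoint Psi_rev (T : set (set E)) (w : seq patch_gens) :
    option patch_states :=
  if w is s :: w' then
    let T' := translate_tiles T (- wval (rev w)) in
    if (Psi_rev T w' == Some (patch_init s)) && `[< Omega_o T' >]
    then patch_at T' else None
  else patch_at T.

Definition Psi (T : tiling_space) (w : seq patch_gens) :
    option patch_states :=
  Psi_rev (set_val T) (rev w).

Lemma patch_atE (T : set (set E)) : Omega_o T ->
  exists2 m, patch_at T = Some m & set_val m = meet_patch T (patch_ball 0).
Proof.
move=> oT; rewrite /patch_at; case: insubP => [m _ mE|]; first by exists m.
by case/negP; apply/mem_set; exists T.
Qed.

Lemma Psi_nil T : Psi T [::] = patch_at (set_val T).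
Proof. by []. Qed.

Lemma Psi_rcons T w s :
  Psi T (rcons w s) =
  let T' := translate_tiles (set_val T) (- wval (rcons w s)) in
  if (Psi T w == Some (patch_init s)) && `[< Omega_o T' >]
  then patch_at T' else None.
Proof. by rewrite /Psi rev_rcons /= -rev_rcons revK. Qed.

End tilings.

Arguments patch_states {R d} P K.
Arguments patch_gens {R d} P K.
Arguments Psi {R d P} K T w.

Section tiling_metric.
Variables (R : realType) (d : nat) (P : set (set 'rV[R]_d)).
Notation X := (tiling_space P).

Lemma cball_le (x : 'rV[R]_d) r r' : r <= r' -> cball x r `<=` cball x r'.
Proof. by move=> rr' y /le_trans; apply. Qed.

Lemma match_sub (F F' : set 'rV[R]_d) T1 T2 :
  F `<=` F' -> match_in F' T1 T2 -> match_in F T1 T2.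
Proof.
move=> FF' m; apply/seteqP; split=> t [Tt [x [tx Fx]]].
  have [] : meet_patch T2 F' t by rewrite -m; split=> //; exists x; split=> //; exact: FF'.
  by move=> T2t _; split=> //; exists x.
have [] : meet_patch T1 F' t by rewrite m; split=> //; exists x; split=> //; exact: FF'.
by move=> T1t _; split=> //; exists x.
Qed.

Lemma enorm_ge0 (x : 'rV[R]_d) : 0 <= enorm x.
Proof. exact: sqrtr_ge0. Qed.

Lemma enorm0 : enorm (0 : 'rV[R]_d) = 0.
Proof. by rewrite /enorm big1 ?sqrtr0// => i _; rewrite mxE expr0n. Qed.

Lemma tile_nonempty (t : set 'rV[R]_d) : is_tile t -> t !=set0.
Proof.
move=> [f _].
have b0 : (0 : 'rV[R]_d) \in cball 0 1.
  by apply/mem_set; rewrite /cball/= subrr enorm0.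
by have := set_valP (f (exist _ 0 b0)); exists (set_val (f (exist _ 0 b0))).
Qed.

Lemma agreement_ge0 (T1 T2 : set (set 'rV[R]_d)) : (0 <= agreement T1 T2)%E.
Proof. by rewrite /agreement le_max lexx. Qed.

Lemma agreementxx (T : set (set 'rV[R]_d)) : agreement T T = +oo%E.
Proof.
rewrite /agreement hasNub_ereal_sup; first by rewrite max_r// leey.
- move=> [M ubM].
  suff : `|M| + 1 <= M by rewrite leNgt ltr_pwDr// ler_norm.
  by apply: ubM; split => //; rewrite addr_ge0.
- by exists 0; split.
Qed.

Lemma agreement_sym (T1 T2 : set (set 'rV[R]_d)) :
  agreement T1 T2 = agreement T2 T1.
Proof.
rewrite /agreement; congr maxe; congr ereal_sup; congr image.
by apply/seteqP; split=> r [r0 m]; split.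
Qed.

Lemma agreement_mono (T1 T2 T3 T4 : set (set 'rV[R]_d)) :
  agreement_radii T1 T2 `<=` agreement_radii T3 T4 ->
  (agreement T1 T2 <= agreement T3 T4)%E.
Proof.
move=> s; rewrite /agreement ge_max le_max lexx /= le_max.
by rewrite ereal_sup_le ?orbT//; apply: image_subset.
Qed.

Lemma agreementy (T1 T2 : set (set 'rV[R]_d)) :
  agreement T1 T2 = +oo%E -> forall r, match_in (cball 0 r) T1 T2.
Proof.
move=> aoo r; have [|n] := pselect (exists2 r', r <= r' & agreement_radii T1 T2 r').
  by move=> [r' rr' [_]]; apply: match_sub; exact: cball_le.
suff : (agreement T1 T2 <= `|r|%:E)%E by rewrite aoo.
rewrite /agreement ge_max lee_fin normr_ge0 /=; apply: ge_ereal_sup => _ [r' Ar' <-].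
rewrite lee_fin; have [rr'|/ltW r'r] := leP r r'; first by case: n; exists r'.
by rewrite (le_trans r'r)// ler_norm.
Qed.

Lemma tdist_ge0 (T1 T2 : set (set 'rV[R]_d)) : 0 <= tdist T1 T2.
Proof. by rewrite /tdist; case: agreement => // r; rewrite powR_ge0. Qed.

Lemma tdist_anti (T1 T2 T3 T4 : set (set 'rV[R]_d)) :
  (agreement T1 T2 <= agreement T3 T4)%E -> tdist T3 T4 <= tdist T1 T2.
Proof.
have := agreement_ge0 T1 T2; have := tdist_ge0 T1 T2.
rewrite /tdist; case: (agreement T1 T2) => [r| |]; case: agreement => [r'| |] //=.
by move=> _ _; rewrite lee_fin => rr'; rewrite ler_powR ?lerN2// ler1n.
Qed.

Lemma tdistxx (T : X) : tdist (set_val T) (set_val T) = 0.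
Proof. by rewrite /tdist agreementxx. Qed.

Lemma tdist_sym (T1 T2 : X) :
  tdist (set_val T1) (set_val T2) = tdist (set_val T2) (set_val T1).
Proof. by rewrite /tdist agreement_sym. Qed.

Lemma tdist_positivity (T1 T2 : X) :
  tdist (set_val T1) (set_val T2) = 0 -> T1 = T2.
Proof.
rewrite /tdist; case E: agreement (agreement_ge0 (set_val T1) (set_val T2)) => [r| |]; last by [].
  by move=> _ /eqP; rewrite powR_eq0 pnatr_eq0.
move=> _ _; have m := agreementy E; apply/val_inj.
have [[[[tl1 _] _] _] _] := set_valP T1.
have [[[[tl2 _] _] _] _] := set_valP T2.
have H (x : 'rV[R]_d) : cball 0 (enorm x) x by rewrite /cball/= subr0.
apply/seteqP; split=> t Tt.
  have [x tx] := tile_nonempty (tl1 _ Tt).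
  suff [] : meet_patch (set_val T2) (cball 0 (enorm x)) t by [].
  by rewrite -(m (enorm x)); split => //; exists x.
have [x tx] := tile_nonempty (tl2 _ Tt).
suff [] : meet_patch (set_val T1) (cball 0 (enorm x)) t by [].
by rewrite (m (enorm x)); split => //; exists x.
Qed.

Lemma tdist_triangle (T2 T1 T3 : X) :
  tdist (set_val T1) (set_val T3) <=
  tdist (set_val T1) (set_val T2) + tdist (set_val T2) (set_val T3).
Proof.
set a := set_val T1; set b := set_val T2; set c := set_val T3.
have [s|/existsNP[r /not_implyP[abr nbcr]]] :=
    pselect (agreement_radii a b `<=` agreement_radii b c).
  rewrite (@le_trans _ _ (tdist a b))// ?lerDl ?tdist_ge0//.
  apply/tdist_anti/agreement_mono => r abr; have [_ m'] := s _ abr.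
  by case: abr => r0 m; split=> //; rewrite /match_in m.
rewrite (@le_trans _ _ (tdist b c))// ?lerDr ?tdist_ge0//.
apply/tdist_anti/agreement_mono => r' [r'0 m']; split=> //.
have [rr'|/ltW r'r] := leP r r'.
  case: nbcr; split; first by case: abr.
  exact: match_sub (cball_le rr') m'.
by rewrite /match_in -m'; case: abr => _; apply: match_sub; exact: cball_le.
Qed.

End tiling_metric.

HB.instance Definition _ (R : realType) (d : nat) (P : set (set 'rV[R]_d)) :=
  gen_eqMixin (tiling_space P).
HB.instance Definition _ (R : realType) (d : nat) (P : set (set 'rV[R]_d)) :=
  gen_choiceMixin (tiling_space P).
HB.instance Definition _ (R : realType) (d : nat) (P : set (set 'rV[R]_d)) :=
  isMetric.Build R (tiling_space P) (@tdistxx R d P) (@tdist_positivity R d P)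
    (@tdist_sym R d P) (@tdist_triangle R d P).

Section euclid.
Variables (R : realType) (d : nat).
Notation E := ('rV[R]_d).
Implicit Types (x y v : E) (t : set E).

Lemma enorm_sqr x : enorm x ^+ 2 = \sum_(i < d) x ord0 i ^+ 2.
Proof. by rewrite /enorm sqr_sqrtr// sumr_ge0// => i _; rewrite sqr_ge0. Qed.

Lemma enorm_eq0 x : enorm x = 0 -> x = 0.
Proof.
move=> x0; apply/rowP => i; rewrite mxE; apply/eqP.
have /eqP := enorm_sqr x; rewrite x0 expr0n /= eq_sym psumr_eq0; last first.
  by move=> j _; rewrite sqr_ge0.
by move=> /allP /(_ i); rewrite mem_index_enum sqrf_eq0 => /(_ isT).
Qed.

Lemma enormN x : enorm (- x) = enorm x.
Proof. by rewrite /enorm; congr Num.sqrt; apply: eq_bigr => i _; rewrite mxE sqrrN. Qed.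

Lemma enorm_dot x y : \sum_(i < d) x ord0 i * y ord0 i <= enorm x * enorm y.
Proof.
have [/enorm_eq0 ->|x0] := eqVneq (enorm x) 0.
  by rewrite enorm0 mul0r big1// => i _; rewrite mxE mul0r.
have [/enorm_eq0 ->|y0] := eqVneq (enorm y) 0.
  by rewrite enorm0 mulr0 big1// => i _; rewrite mxE mulr0.
set a := enorm x in x0 *; set b := enorm y in y0 *; set c := (X in X <= _).
have ab : 0 < a * b by rewrite mulr_gt0// lt0r ?x0 ?y0 enorm_ge0.
have : 0 <= \sum_(i < d) (b * x ord0 i - a * y ord0 i) ^+ 2.
  by rewrite sumr_ge0// => i _; rewrite sqr_ge0.
have -> : \sum_(i < d) (b * x ord0 i - a * y ord0 i) ^+ 2 =
    b ^+ 2 * (\sum_(i < d) x ord0 i ^+ 2) + a ^+ 2 * (\sum_(i < d) y ord0 i ^+ 2)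
    - 2 * (a * b) * c.
  rewrite /c !mulr_sumr -big_split/= -sumrB.
  by apply: eq_bigr => i _; ring.
rewrite -!enorm_sqr -/a -/b.
move=> h; rewrite -(ler_pM2l ab); nra.
Qed.

Lemma enormD x y : enorm (x + y) <= enorm x + enorm y.
Proof.
rewrite -(@ler_pXn2r _ 2)// ?nnegrE ?addr_ge0 ?enorm_ge0//.
rewrite sqrrD !enorm_sqr.
have -> : \sum_(i < d) (x + y) ord0 i ^+ 2 = \sum_(i < d) x ord0 i ^+ 2 +
   (\sum_(i < d) x ord0 i * y ord0 i) *+ 2 + \sum_(i < d) y ord0 i ^+ 2.
  rewrite -sumrMnl -!big_split/=; apply: eq_bigr => i _.
  by rewrite mxE sqrrD.
by rewrite lerD2r lerD2l lerMn2r /= enorm_dot.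
Qed.

Lemma norm_le_enorm x : `|x| <= enorm x.
Proof.
rewrite /Num.norm/= mx_normrE; apply/bigmax_leP; split=> [|[i j] _ /=].
  exact: enorm_ge0.
rewrite -(@ler_pXn2r _ 2)// ?nnegrE ?enorm_ge0// enorm_sqr real_normK ?num_real//.
by rewrite (ord1 i) (bigD1 j)//= lerDl sumr_ge0// => k _; rewrite sqr_ge0.
Qed.

Lemma enorm_continuous : continuous (@enorm R d).
Proof.
have sqc i : continuous (fun y : E => y ord0 i ^+ 2).
  move=> y; apply: (@continuous_comp _ _ _ (fun x : E => x ord0 i)
    (fun a : R => a ^+ 2)); first exact: coord_continuous.
  exact: exprn_continuous.
have sumc (r : seq 'I_d) : continuous (fun y : E => \sum_(i <- r) y ord0 i ^+ 2).
  elim: r => [|i r IH].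
    have -> : (fun x : E => \sum_(i <- [::]) x ord0 i ^+ 2) = cst 0.
      by apply/funext => y; rewrite big_nil.
    exact: cst_continuous.
  have -> : (fun x : E => \sum_(j <- i :: r) x ord0 j ^+ 2) =
      (fun x => x ord0 i ^+ 2 + \sum_(j <- r) x ord0 j ^+ 2).
    by apply/funext => y; rewrite big_cons.
  by move=> y; exact: (cvgD (sqc i y) (IH y)).
move=> x; apply: (@continuous_comp _ _ _
  (fun x : E => \sum_(i < d) x ord0 i ^+ 2) (@Num.sqrt R)).
  exact: sumc.
exact: sqrt_continuous.
Qed.

Lemma compact_cball0 r : compact (cball (0 : E) r).
Proof.
apply: bounded_closed_compact.
  exists r; split; first exact: num_real.
  move=> s rs x; rewrite /cball/= subr0 => xr.
  by rewrite (le_trans (norm_le_enorm x))// (le_trans xr)// ltW.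
have -> : cball (0 : E) r = (@enorm R d) @^-1` [set s | s <= r].
  by apply/seteqP; split=> x; rewrite /cball/= subr0.
apply: preimage_closed; last exact: closed_le.
by move=> x _; exact: enorm_continuous.
Qed.

Lemma tile_compact t : is_tile t -> compact t.
Proof.
move=> [f [g [_ gK cf _]]].
have cf' : continuous (set_val \o f : set_type (cball (0:E) 1) -> E).
  move=> x; apply: continuous_comp; first exact: cf.
  exact: initial_continuous.
have vE a : valL_ 0 (set_val \o f : set_type (cball (0:E) 1) -> E) (set_val a) =
    set_val (f a).
  by have /(congr1 (fun h => h a)) := (@valLK _ _ (0:E) (cball (0:E) 1)) (set_val \o f).
have -> : t = valL_ 0 (set_val \o f : set_type (cball (0:E) 1) -> E) @` cball 0 1.
  apply/seteqP; split => [x tx|_ [x bx <-]].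
    pose x' : set_type t := exist _ x (mem_set tx).
    exists (set_val (g x')); first exact: set_valP.
    by rewrite vE gK.
  by rewrite -[x]/(set_val (exist _ x (mem_set bx))) vE; exact: set_valP.
apply: continuous_compact; last exact: compact_cball0.
exact/subspace_valL_continuousP'.
Qed.
End euclid.

Section translations.
Variables (R : realType) (d : nat).
Notation E := ('rV[R]_d).
Implicit Types (x y v : E) (t : set E) (T : set (set E)).

Lemma translateE t v : translate t v = (fun x => x - v) @^-1` t.
Proof.
apply/seteqP; split=> [_ [y ty <-]|x tx] /=; first by rewrite addrK.
by exists (x - v) => //; rewrite subrK.
Qed.

Lemma translateD t v x : translate (translate t v) x = translate t (v + x).
Proof.
by rewrite !translateE; apply/seteqP; split=> y /=; rewrite opprD addrA [y - x - v]addrAC.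
Qed.

Lemma translate0 t : translate t 0 = t.
Proof. by rewrite translateE; apply/seteqP; split=> y /=; rewrite subr0. Qed.

Lemma sub_cst_continuous v : continuous (fun x : E => x - v).
Proof. by move=> x; exact: (cvgB (@cvg_id _ (nbhs x)) (cvg_cst v)). Qed.

Lemma interior_translate t v x :
  interior (translate t v) x <-> interior t (x - v).
Proof.
have H s w y : interior s (y - w) -> interior (translate s w) y.
  by rewrite translateE; exact: sub_cst_continuous.
split=> [|/H//]; rewrite -{2}(translate0 t) -(subrr v) -translateD => tx.
by apply: H; rewrite opprK subrK.
Qed.

Lemma translate_tile t v : is_tile t -> is_tile (translate t v).
Proof.
move=> [f [g [fK gK cf cg]]].
have to_ (a : set_type t) : set_val a + v \in translate t v.
  by apply/mem_set; exists (set_val a) => //; exact: set_valP.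
have from_ (a : set_type (translate t v)) : set_val a - v \in t.
  by apply/mem_set; have := set_valP a; rewrite {1}translateE.
pose h (a : set_type t) : set_type (translate t v) := SigSub (to_ a).
pose k (a : set_type (translate t v)) : set_type t := SigSub (from_ a).
have hK : cancel h k by move=> a; apply/val_inj; rewrite /= addrK.
have kK : cancel k h by move=> a; apply/val_inj; rewrite /= subrK.
have ch : continuous h.
  apply: continuous_comp_initial => a /=.
  apply: (@continuous_comp _ _ _ set_val (fun x : E => x + v)).
    exact: initial_continuous.
  by rewrite -(opprK v); exact: sub_cst_continuous.
have ck : continuous k.
  apply: continuous_comp_initial => a /=.
  apply: (@continuous_comp _ _ _ set_val (fun x : E => x - v)).
    exact: initial_continuous.
  exact: sub_cst_continuous.
exists (h \o f), (g \o k); split.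
- by move=> a /=; rewrite hK fK.
- by move=> a /=; rewrite gK kK.
- by move=> a; apply: continuous_comp; [exact: cf|exact: ch].
- by move=> a; apply: continuous_comp; [exact: ck|exact: cg].
Qed.

End translations.

Section punctured.
Variables (R : realType) (d : nat) (P : set (set 'rV[R]_d)).
Notation E := ('rV[R]_d).
Implicit Types (x y v : E) (t : set E) (T : set (set E)).
Hypothesis hP : punctured_tiles P.

Lemma posE t v : pos_spec P t v -> pos P t = v.
Proof.
move=> tv; rewrite /pos; case: xgetP => [w _ /=|/(_ v)//].
case: tv => p Pp -> [q Pq] pq; have [_ _ u] := hP.
have : p = translate q (w - v).
  by rewrite -translateD -pq translateD subrr translate0.
by move=> /(u _ _ _ Pp Pq)[_ /eqP]; rewrite subr_eq0 => /eqP.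
Qed.

Lemma Omega_pos T t : Omega P T -> T t -> pos_spec P t (pos P t).
Proof. by move=> [_ pT] /pT[v tv]; rewrite (posE tv). Qed.

Lemma tile_pos_interior T t : Omega P T -> T t -> interior t (pos P t).
Proof.
move=> oT Tt; have [p Pp tE] := Omega_pos oT Tt; rewrite {1}tE.
by apply/interior_translate; rewrite subrr; have [_ /(_ _ Pp)[]] := hP.
Qed.

Lemma Omega_o_translate T t : Omega P T -> T t ->
  Omega_o P (translate_tiles T (- pos P t)).
Proof.
move=> oT Tt; have [[[tl dj] cov] pT] := oT; split; last first.
  exists (translate t (- pos P t)); first by exists t.
  have [p Pp tE] := Omega_pos oT Tt.
  by apply: posE; exists p => //; rewrite {1}tE translateD subrr.
split; last first.
  move=> _ [s Ts <-]; have [p Pp sE] := Omega_pos oT Ts.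
  by exists (pos P s - pos P t), p => //; rewrite {1}sE translateD.
split; [split|].
- by move=> _ [s Ts <-]; apply/translate_tile/tl.
- move=> _ _ [s Ts <-] [s' Ts' <-] ss'; apply/seteqP; split=> // x.
  move=> [/interior_translate xs /interior_translate xs'].
  have nss : s <> s' by move=> ss; apply: ss'; rewrite ss.
  by have /seteqP[/(_ (x - - pos P t)) + _] := dj s s' Ts Ts' nss; apply; split.
- apply/seteqP; split=> // x _.
  have : (\bigcup_(t in T) t) (x + pos P t) by rewrite cov.
  move=> [s Ts xs]; exists (translate s (- pos P t)); first by exists s.
  by rewrite translateE /= opprK.
Qed.

Lemma rho_set_nonempty :
  [set r : R | 0 < r /\ forall p, P p -> p `<=` cball 0 r] !=set0.
Proof.
have [fP tP _] := hP.
have bnd p : P p -> exists r : R, 0 < r /\ p `<=` cball 0 r.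
  move=> /tP[tp _].
  have [c _ cm] := @EVT_max_rV R d (@enorm R d) p (tile_nonempty tp) (tile_compact tp)
    (continuous_subspaceT (@enorm_continuous R d)).
  exists (enorm c + 1); split; first by rewrite ltr_wpDl ?enorm_ge0.
  by move=> x px; rewrite /cball/= subr0 (le_trans (cm x (mem_set px)))// lerDl.
have /finite_seqP[s sE] := fP.
have {}bnd p : p \in s -> exists r : R, 0 < r /\ p `<=` cball 0 r.
  by move=> ps; apply: bnd; rewrite sE.
suff [r [r0 rs]] : exists r : R, 0 < r /\ forall p, p \in s -> p `<=` cball 0 r.
  by exists r; split => // p; rewrite sE => /rs.
elim: s {sE} bnd => [_|p s IH bnd]; first by exists 1; split.
have [q qs|r [r0 rs]] := IH; first by apply: bnd; rewrite inE qs orbT.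
have [|r' [r'0 r's]] := bnd p; first by rewrite inE eqxx.
exists (Num.max r r'); split; first by rewrite lt_max r0.
move=> q; rewrite inE => /predU1P[->|qs].
  by apply: subset_trans r's _; apply: cball_le; rewrite le_max lexx orbT.
by apply: subset_trans (rs _ qs) _; apply: cball_le; rewrite le_max lexx.
Qed.

Lemma rho_ge0 : 0 <= rho P.
Proof. by apply: lb_le_inf; [exact: rho_set_nonempty|move=> r [/ltW]]. Qed.

Lemma tile_sub_rho p : P p -> p `<=` cball 0 (rho P).
Proof.
move=> Pp x px; rewrite /cball/= subr0; apply: lb_le_inf; first exact: rho_set_nonempty.
by move=> r [_ /(_ p Pp x px)]; rewrite /cball/= subr0.
Qed.

Lemma tile_dist T t x : Omega P T -> T t -> t x -> enorm (x - pos P t) <= rho P.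
Proof.
move=> oT Tt; have [p Pp {1}->] := Omega_pos oT Tt.
by rewrite translateE => /(tile_sub_rho Pp); rewrite /cball/= subr0.
Qed.

Lemma patch_states_nonempty K : Omega_o P !=set0 -> [set: patch_states P K] !=set0.
Proof.
move=> [T oT].
have H : meet_patch T (patch_ball P K 0) \in patch_states P K.
  by apply/mem_set; exists T.
by exists (SigSub H).
Qed.

Lemma match_translate T v (B : set E) :
  match_in (B `&` translate B v)
    (translate_tiles (meet_patch (translate_tiles T (- v)) B) v) (meet_patch T B).
Proof.
apply/seteqP; split=> t.
  move=> [[_ [[s Ts <-] _] <-]]; rewrite translateD addNr translate0.
  by move=> [x [sx [Bx Bvx]]]; split; [split=> //|]; exists x.
move=> [[Tt _] [x [tx [Bx Bvx]]]]; split; last by exists x.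
exists (translate t (- v)); last by rewrite translateD addNr translate0.
split; first by exists t.
exists (x - v); split; first by rewrite translateE /= opprK subrK.
by move: Bvx; rewrite translateE.
Qed.

Lemma patch_ballE K v : patch_ball P K v = translate (patch_ball P K 0) v.
Proof. by rewrite translateE; apply/seteqP; split=> x; rewrite /patch_ball/cball/= subr0. Qed.

Lemma patch_term_nonempty K (s : patch_gens P K) : patch_term s !=set0.
Proof.
have [T oT Tm] := set_valP (set_val s).1.
have [_ [t tm vE]] := set_valP s.
have [Tt _] : meet_patch T (patch_ball P K 0) t by rewrite Tm.
have H : meet_patch (translate_tiles T (- gval s)) (patch_ball P K 0)
    \in patch_states P K.
  apply/mem_set; exists (translate_tiles T (- gval s)) => //.
  by rewrite /gval vE; apply: Omega_o_translate => //; case: oT.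
exists (SigSub H); have := match_translate T (gval s) (patch_ball P K 0).
by rewrite -patch_ballE Tm.
Qed.

Lemma patch_gens_nonempty K : (0 < d)%N -> (0 < K)%N -> Omega_o P !=set0 ->
  [set: patch_gens P K] !=set0.
Proof.
move=> d0 K0 [T oT]; have [oT' _] := oT; have [[[tl dj] cov] _] := oT'.
pose e : E := delta_mx ord0 (Ordinal d0).
have ne a : enorm (a *: e) = `|a|.
  rewrite /enorm (bigD1 (Ordinal d0))//= big1; last first.
    by move=> i /negbTE ni; rewrite !mxE eqxx ni /= mulr0 expr0n.
  by rewrite !mxE !eqxx mulr1 addr0 sqrtr_sqr.
pose x n : E := (rho P + n.+1%:R^-1) *: e.
have nx n : enorm (x n) = rho P + n.+1%:R^-1.
  by rewrite ne ger0_norm// addr_ge0 ?rho_ge0.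
have ex n : exists t, T t /\ t (x n).
  have [t Tt tx] : (\bigcup_(t in T) t) (x n) by rewrite cov.
  by exists t.
pose t n := proj1_sig (cid (ex n)).
have Tt n : T (t n) by rewrite /t; case: cid => ? [].
have tx n : t n (x n) by rewrite /t; case: cid => ? [].
pose q n := pos P (t n).
have qx n : enorm (x n - q n) <= rho P by exact: (tile_dist oT' (Tt n) (tx n)).
have qb n : cball 0 (rho P + 1 + rho P) (q n).
  rewrite /cball/= subr0 -[q n](subKr (x n)) (le_trans (enormD _ _))// enormN.
  by rewrite lerD// nx lerD2l invf_le1 ?ler1n.
have Fq : (q @ \oo) (cball 0 (rho P + 1 + rho P)) by exists 0%N => // n _; exact: qb.
have [q0 [_ clq]] := @compact_cball0 R d (rho P + 1 + rho P) (q @ \oo) _ Fq.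
(* near a cluster point of the positions, all the tiles coincide *)
have [U [U0 Ui]] : exists U : set E, nbhs (0 : E) U /\ forall p, P p -> U `<=` interior p.
  have [fP tP _] := hP; have /finite_seqP[s sE] := fP.
  have {tP}: forall p, p \in s -> nbhs (0 : E) (interior p).
    move=> p ps; have Pp : P p by rewrite sE.
    by have [_] := tP p Pp; exact: nbhs_interior.
  move=> ns; suff [U [U0 Us]] : exists U : set E, nbhs (0 : E) U /\ forall p, p \in s -> U `<=` interior p.
    by exists U; split => // p; rewrite sE; exact: Us.
  elim: s {sE} ns => [_|p s IH ns]; first by exists setT; split => //; exact: filterT.
  have [r rs|U [U0 Us]] := IH; first by apply: ns; rewrite inE rs orbT.
  exists (U `&` interior p); split.
    by apply: filterI => //; apply: ns; rewrite inE eqxx.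
  by move=> r; rewrite inE => /predU1P[->|/Us rs] y [] // /rs.
have [V V0 VU] : exists2 V : set E, nbhs q0 V & forall a b, V a -> V b -> U (a - b).
  have := @sub_continuous E (q0, q0); rewrite /continuous_at /= subrr => /(_ _ U0).
  move=> [[A B]] /= [Aq Bq] AB; exists (A `&` B); first exact: filterI.
  by move=> a b [Aa _] [_ Bb]; exact: (AB (a, b)).
have same n m : V (q n) -> V (q m) -> t n = t m.
  move=> Vn Vm; apply: contrapT => tnm.
  have /seteqP[/(_ (q n)) + _] := dj _ _ (Tt n) (Tt m) tnm; apply; split.
    exact: (tile_pos_interior oT').
  have [p Pp tE] := Omega_pos oT' (Tt m); rewrite tE.
  by apply/interior_translate; apply: (Ui _ Pp); apply: VU.
have often N : exists2 n, (N <= n)%N & V (q n).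
  have [|_ [[n Nn <-] Vn]] := clq (q @` [set n | (N <= n)%N]) V _ V0.
    by exists N => // n /= Nn; exists n.
  by exists n.
have [n0 _ Vn0] := often 0.
pose t0 := t n0.
have t0x n : V (q n) -> t0 (x n) by move=> Vn; rewrite /t0 (same _ _ Vn0 Vn).
have t0e : t0 (rho P *: e).
  have ct0 : closed t0 by apply: compact_closed; [exact: norm_hausdorff|exact/tile_compact/tl/Tt].
  apply: ct0 => W We.
  have cx : x n @[n --> \oo] --> rho P *: e.
    apply: cvgZr_tmp; rewrite -[X in _ --> X]addr0.
    by apply: cvgD; [exact: cvg_cst|exact: cvg_harmonic].
  have [N _ NW] := cx _ We; have [n Nn Vn] := often N.
  by exists (x n); split; [exact: t0x|exact: NW].
have Tt0 : T t0 by exact: Tt.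
have m_in : meet_patch T (patch_ball P K 0) \in patch_states P K.
  by apply/mem_set; exists T.
have H : (SigSub m_in : patch_states P K, pos P t0) \in patch_gens P K.
  apply/mem_set; split=> /=; last first.
    exists t0 => //; split => //; exists (rho P *: e); split => //.
    rewrite /patch_ball/cball/= subr0 ne ger0_norm ?rho_ge0//.
    by rewrite ler_peMl ?rho_ge0// ler1n.
  apply/andP; split.
    rewrite lt_neqAle enorm_ge0 andbT eq_sym; apply/eqP => /enorm_eq0 p0.
    have := qx n0; rewrite /q -/t0 p0 subr0 nx -{2}[rho P]addr0 lerD2l.
    by rewrite leNgt invr_gt0 ltr0Sn.
  rewrite -[pos P t0](subKr (rho P *: e)) (le_trans (enormD _ _))// enormN.
  have := tile_dist oT' Tt0 t0e; rewrite ne ger0_norm ?rho_ge0//.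
  have := rho_ge0; lra.
by exists (SigSub H).
Qed.
End punctured.

Definition patch_blueprint (R : realType) (d : nat) (P : set (set 'rV[R]_d))
    (d_gt0 : (0 < d)%N) (hP : punctured_tiles P) (hO : Omega_o P !=set0)
    (K L : nat) (K_gt0 : (0 < K)%N) : blueprint :=
  @Blueprint (patch_states P K) (patch_gens P K) (@patch_init R d P K)
    (@patch_term R d P K) (@patch_rels R d P K L)
    (patch_states_nonempty K hO) (patch_gens_nonempty hP d_gt0 K_gt0 hO)
    (@patch_term_nonempty R d P hP K).

(* Main.v *)
Require Import Defs.
From mathcomp Require Import all_boot all_order all_algebra.
From mathcomp Require Import all_classical all_reals all_analysis.
From mathcomp Require Import finmap lra zify.
From Stdlib Require Import Relation_Operators.
Set Implicit Arguments.
Unset Strict Implicit.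
Unset Printing Implicit Defensive.
Import Order.TTheory GRing.Theory Num.Theory.
Import numFieldNormedType.Exports.
Local Open Scope classical_set_scope.
Local Open Scope ring_scope.

(* Let [phi] be a model and place the patch [phi w] at [val w] for every word [w]
   in its support.  Patches of consecutive words match on the common part of their
   balls, and any two short words from a common word to the same end point are
   exchangeable by a relation.  Continuing [phi] along the segments from the origin,
   in steps of length at most [rho], gives a word [c x] ending near each point [x].
   By induction on the radius, [c x] and [c y] are joined by a short path
   whenever [x] and [y] are close: each cell of the ladder between the two segments
   is a short loop, and the relations fill it.  This is how simple connectedness of
   the Euclidean space enters.  By induction on its length, every word [w] of the
   support is then joined by a short path to [c (val w)].  So two words that end near
   the same point see the same tiles there, the placed patches glue to a tiling [T],
   and [phi] is the image of [T].  For continuity of the inverse, a closed ball is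
   covered by finitely many balls around ends of words of the support, hence the
   tiling on it is determined by finitely many values of [phi]. *)

(** * Translates of tilings *)

Section euclidean_space.
Variables (R : realType) (d : nat).
Notation E := 'rV[R]_d.
Implicit Types (x y z u v : E) (t : set E) (T : set (set E)).

Lemma enormZ (a : R) x : enorm (a *: x) = `|a| * enorm x.
Proof.
rewrite /enorm -sqrtr_sqr -sqrtrM ?sqr_ge0// mulr_sumr; congr Num.sqrt.
by apply: eq_bigr => i _; rewrite mxE exprMn.
Qed.

Lemma enorm_distC x y : enorm (x - y) = enorm (y - x).
Proof. by rewrite -enormN opprB. Qed.

Lemma enorm_triangle y x z : enorm (x - z) <= enorm (x - y) + enorm (y - z).
Proof. by rewrite -{1}(subrK y x) -addrA enormD. Qed.

Lemma exists_enorm (r : R) : (0 < d)%N -> exists x, enorm x = `|r|.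
Proof.
move=> d0; exists (r *: delta_mx ord0 (Ordinal d0)); rewrite enormZ.
suff -> : enorm (delta_mx ord0 (Ordinal d0) : E) = 1 by rewrite mulr1.
rewrite /enorm (bigD1 (Ordinal d0))//= big1; last first.
  by move=> i /negbTE ni; rewrite mxE eqxx ni expr0n.
by rewrite mxE !eqxx expr1n addr0 sqrtr1.
Qed.

(** The witness lies on the line through [u] and [x]; when [x = u] the direction is arbitrary, and
    some direction exists because [d] is positive. *)
Lemma point_towards u x (r : R) : (0 < d)%N ->
  exists2 z, enorm (z - u) = `|r| & enorm (x - z) = `|enorm (x - u) - r|.
Proof.
move=> d0; have [/eqP|xu] := eqVneq (enorm (x - u)) 0.
  move=> /eqP/enorm_eq0/eqP; rewrite subr_eq0 => /eqP ->.
  have [e er] := exists_enorm r d0; exists (u + e); first by rewrite addrC addKr.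
  by rewrite subrr enorm0 sub0r normrN opprD addrA subrr sub0r enormN.
exists (u + (r / enorm (x - u)) *: (x - u)).
  by rewrite addrC addKr enormZ normrM normfV (ger0_norm (enorm_ge0 _)) divfK.
rewrite opprD addrA -{1}[x - u]scale1r -scalerBl enormZ.
by rewrite -{2}(ger0_norm (enorm_ge0 (x - u))) -normrM mulrBl mul1r divfK.
Qed.

Lemma translate_tilesE T v t : translate_tiles T v t <-> T (translate t (- v)).
Proof.
split=> [[s Ts <-]|Tt]; first by rewrite translateD subrr translate0.
by exists (translate t (- v)); rewrite // translateD addNr translate0.
Qed.

Lemma translateN_mem t v x : translate t (- v) (x - v) <-> t x.
Proof. by rewrite translateE /= opprK subrK. Qed.

Lemma translate_tilesD T v u :
  translate_tiles (translate_tiles T v) u = translate_tiles T (v + u).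
Proof.
by apply/seteqP; split=> t;
  rewrite !translate_tilesE translateD -opprD (addrC u v).
Qed.

Lemma translate_tiles0 T : translate_tiles T 0 = T.
Proof. by apply/seteqP; split=> t; rewrite translate_tilesE oppr0 translate0. Qed.

Lemma meet_patch_translate T (F : set E) v :
  meet_patch (translate_tiles T v) (translate F v) =
  translate_tiles (meet_patch T F) v.
Proof.
apply/seteqP; split=> t; rewrite translate_tilesE.
  move=> [/translate_tilesE Tt [x [tx Fx]]]; split=> //.
  by exists (x - v); split; [rewrite translateN_mem|rewrite translateE in Fx].
move=> [Tt [x [tx Fx]]]; split; first exact/translate_tilesE.
exists (x + v); split; first by rewrite -(translateN_mem t v) addrK.
by rewrite translateE /= addrK.
Qed.

Lemma match_in_bigcup (I : Type) (D : set I) (F : I -> set E) T T' (A : set E) :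
  A `<=` \bigcup_(i in D) F i -> (forall i, D i -> match_in (F i) T T') ->
  match_in A T T'.
Proof.
move=> AF m; suff H (T1 T2 : set (set E)) :
    (forall i, D i -> match_in (F i) T1 T2) -> meet_patch T1 A `<=` meet_patch T2 A.
  by apply/seteqP; split; apply: H => // i Di; rewrite /match_in m.
move=> {}m t [Tt [x [tx Ax]]]; have [i Di Fx] := AF _ Ax.
have [T2t _] : meet_patch T2 (F i) t by rewrite -m//; split=> //; exists x.
by split=> //; exists x.
Qed.

End euclidean_space.

Section punctured_tilings.
Variables (R : realType) (d : nat) (P : set (set 'rV[R]_d)).
Notation E := 'rV[R]_d.
Hypothesis hP : punctured_tiles P.
Implicit Types (x y z u v : E) (t : set E) (T : set (set E)).

Lemma pos_spec_translate t v u : pos_spec P t v -> pos_spec P (translate t u) (v + u).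
Proof. by move=> [p Pp ->]; exists p => //; rewrite translateD. Qed.

Lemma Omega_translate T v : Omega P T -> Omega P (translate_tiles T v).
Proof.
move=> oT; have [[[tl dj] cov] pT] := oT; split; last first.
  by move=> _ [s Ts <-]; have [u su] := pT _ Ts; exists (u + v); exact: pos_spec_translate.
split; [split|].
- by move=> _ [s Ts <-]; apply/translate_tile/tl.
- move=> _ _ [s Ts <-] [s' Ts' <-] ss'; apply/seteqP; split=> // x.
  move=> [/interior_translate xs /interior_translate xs'].
  have nss : s <> s' by move=> ss; apply: ss'; rewrite ss.
  by have /seteqP[/(_ (x - v)) + _] := dj s s' Ts Ts' nss; apply; split.
- apply/seteqP; split=> // x _.
  have [s Ts xs] : (\bigcup_(t in T) t) (x - v) by rewrite cov.
  by exists (translate s v); [exists s|rewrite translateE].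
Qed.

Lemma pos_translate T t v : Omega P T -> T t ->
  pos P (translate t v) = pos P t + v.
Proof.
by move=> oT Tt; apply: (Defs.posE hP); apply: pos_spec_translate;
  exact: (Omega_pos hP oT Tt).
Qed.

Lemma Omega_o_at T t v : Omega P T -> T t -> pos P t = v ->
  Omega_o P (translate_tiles T (- v)).
Proof. by move=> oT Tt <-; exact: (Omega_o_translate hP). Qed.

Lemma Omega_cover T x : Omega P T -> exists2 t, T t & t x.
Proof. move=> [[_ cov] _]; have [t Tt tx] : (\bigcup_(t in T) t) x by rewrite cov.
by exists t. Qed.

(** A tile is a neighbourhood of its puncture, so in positive dimension it does not fit in a ball of
    radius 0. *)
Lemma rho_gt0 : (0 < d)%N -> Omega_o P !=set0 -> 0 < rho P.
Proof.
move=> d0 [T [oT _]]; have [t Tt _] := Omega_cover 0 oT.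
have [p Pp _] := Omega_pos hP oT Tt; have [_ /(_ p Pp) [_ p0] _] := hP.
have [e /= e0 ep] : exists2 e : R, 0 < e & ball (0 : E) e `<=` p by exact/nbhs_ballP.
rewrite lt_neqAle rho_ge0// andbT; apply/eqP => r0.
(* [ball] refers to the sup norm, for which this nonzero vector has norm [e / 2]. *)
pose x : E := const_mx (e / 2).
have px : p x.
  apply: ep; rewrite -ball_normE /= sub0r normrN.
  have -> : x = (e / 2) *: const_mx 1 by apply/matrixP => i j; rewrite !mxE mulr1.
  rewrite normrZ (@le_lt_trans _ _ `|e / 2|)//; last by rewrite gtr0_norm; lra.
  rewrite ler_piMr//  /Num.norm/= mx_normrE; apply/bigmax_leP; split=> //= i _.
  by rewrite mxE normr1.
have := tile_sub_rho hP Pp px; rewrite /cball /= subr0 -r0 => xle.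
have /enorm_eq0/rowP/(_ (Ordinal d0)) : enorm x = 0.
  by apply/eqP; rewrite eq_le xle enorm_ge0.
by rewrite !mxE; lra.
Qed.

End punctured_tilings.

(** * Gluing the patches of a model *)

Section development.
Variables (R : realType) (d : nat) (P : set (set 'rV[R]_d)).
Notation E := 'rV[R]_d.
Hypotheses (d_gt0 : (0 < d)%N) (hP : punctured_tiles P) (r_gt0 : 0 < rho P).
Variables (K : nat) (hK : (117 <= K)%N).
Notation word := (seq (patch_gens P K)).
Notation r := (rho P).
Variable phi : word -> option (patch_states P K).
Hypothesis phi_nil : phi [::] <> None.
Hypothesis phi_rcons : forall w s,
  (phi w = Some (patch_init s) ->
    exists2 m, phi (rcons w s) = Some m & patch_term s m) /\
  (phi w <> Some (patch_init s) -> phi (rcons w s) = None).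
Implicit Types (x : E) (t : set E) (u v w y z : word) (k : nat).

(** The patch of [u], moved to the end of [u]. It is empty outside the support, so containing a tile
    already puts [u] in the support. *)
Definition dev u : set (set E) :=
  if phi u is Some m then translate_tiles (set_val m) (wval u) else set0.

Let hKR : 117 * r <= K%:R * r.
Proof. by rewrite ler_pM2r// (ler_nat R 117 K). Qed.

Lemma wval_rcons w (s : patch_gens P K) : wval (rcons w s) = wval w + gval s.
Proof. by rewrite /wval big_rcons. Qed.

Lemma wval_cat u v : wval (u ++ v) = wval u + wval v :> E.
Proof. by rewrite /wval big_cat. Qed.

Lemma wval_nil : wval ([::] : word) = 0.
Proof. by rewrite /wval big_nil. Qed.

Lemma enorm_gval (s : patch_gens P K) : enorm (gval s) <= 3 * r.
Proof. by have [/andP[]] := set_valP s. Qed.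

Lemma enorm_wval w : enorm (wval w) <= (3 * size w)%:R * r.
Proof.
elim/last_ind: w => [|w s IH]; first by rewrite wval_nil enorm0 muln0 mul0r.
rewrite wval_rcons size_rcons (le_trans (enormD _ _))// mulnS natrD mulrDl.
by rewrite addrC lerD// enorm_gval.
Qed.

Lemma phi_prefix u v : phi (u ++ v) <> None -> phi u <> None.
Proof.
elim/last_ind: v => [|v s IH]; first by rewrite cats0.
rewrite -rcons_cat => H; apply: IH => H'; apply: H.
by apply: (phi_rcons _ _).2; rewrite H'.
Qed.

Lemma phi_init u s v : phi (u ++ s :: v) <> None -> phi u = Some (patch_init s).
Proof.
rewrite -cat_rcons => /phi_prefix H; apply: contrapT => H'; apply: H.
exact: (phi_rcons _ _).2.
Qed.

Lemma patch_ball_mem (x x' : E) : patch_ball P K x x' = (enorm (x' - x) <= K%:R * r) :> Prop.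
Proof. by []. Qed.

(** States are patches of actual tilings with a tile at the origin. The witness [T] depends on [u];
    a tiling common to all words only comes from the gluing. *)
Lemma devP u : phi u <> None ->
  exists T, [/\ Omega P T, dev u = meet_patch T (patch_ball P K (wval u)) &
                exists2 t, dev u t & pos P t = wval u].
Proof.
rewrite /dev; case: (phi u) => // m _.
have [T oT Tm] : patch_states P K (set_val m) := set_valP m.
have [OT [t Tt t0]] := oT.
exists (translate_tiles T (wval u)); split; first exact: Omega_translate.
  by rewrite patch_ballE meet_patch_translate; congr translate_tiles; exact: esym.
exists (translate t (wval u)); last by rewrite (pos_translate hP _ OT Tt) t0 add0r.
exists t => //; suff : meet_patch T (patch_ball P K 0) t by rewrite Tm.
split=> //; exists 0; split.
  by have := interior_subset (tile_pos_interior hP OT Tt); rewrite t0.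
by rewrite patch_ball_mem subrr enorm0 mulr_ge0// ltW.
Qed.

Lemma dev_phi u t : dev u t -> phi u <> None.
Proof. by rewrite /dev; case: (phi u). Qed.

Lemma dev_pos_spec u t : dev u t -> pos_spec P t (pos P t).
Proof.
move=> ut; have [T [OT dT _]] := devP (dev_phi ut).
by move: ut; rewrite dT => -[/(Omega_pos hP OT)].
Qed.

Lemma dev_pos_mem u t : dev u t -> t (pos P t).
Proof.
move=> ut; have [T [OT dT _]] := devP (dev_phi ut); move: ut; rewrite dT => -[Tt _].
exact: interior_subset (tile_pos_interior hP OT Tt).
Qed.

Lemma dev_dist u t x : dev u t -> t x -> enorm (x - pos P t) <= r.
Proof.
move=> ut; have [T [OT dT _]] := devP (dev_phi ut); move: ut; rewrite dT => -[Tt _].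
exact: (tile_dist hP OT Tt).
Qed.

Lemma dev_cover u x : phi u <> None -> enorm (x - wval u) <= K%:R * r ->
  exists2 t, dev u t & t x.
Proof.
move=> /devP[T [OT -> _]] xu; have [t Tt tx] := Omega_cover x OT.
by exists t => //; split=> //; exists x.
Qed.

(** This is the matching condition of [patch_term], carried from the origin to the end of [u]: the
    point [x] of [t] lies in both balls. *)
Lemma dev_rcons u s x t : phi (rcons u s) <> None -> t x ->
  enorm (x - wval u) <= K%:R * r -> enorm (x - wval (rcons u s)) <= K%:R * r ->
  dev u t <-> dev (rcons u s) t.
Proof.
move=> us tx xu xus.
have Eu : phi u = Some (patch_init s) by apply: (@phi_init _ _ [::]); rewrite cats1.
have [m Em ms] := (phi_rcons u s).1 Eu; rewrite /dev Eu Em.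
have F0 : (translate t (- wval u) `&` (patch_ball P K 0 `&` patch_ball P K (gval s))) !=set0.
  exists (x - wval u); split; first by rewrite translateN_mem.
  split; rewrite patch_ball_mem; first by rewrite subr0.
  by rewrite -addrA -opprD -wval_rcons.
rewrite !translate_tilesE.
have -> : translate t (- wval (rcons u s)) = translate (translate t (- wval u)) (- gval s).
  by rewrite translateD -opprD wval_rcons.
rewrite -(translate_tilesE (set_val m) (gval s)).
have /seteqP[h1 h2] := ms; split=> H.
  by have [] := h2 _ (conj H F0).
by have [] := h1 _ (conj H F0).
Qed.

(** A letter moves the end by at most [3 * r], so the balls at all the intermediate words contain
    [x]. *)
Lemma dev_cat u v x t : phi (u ++ v) <> None -> t x ->
  enorm (x - wval u) + (3 * size v)%:R * r <= K%:R * r ->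
  dev u t <-> dev (u ++ v) t.
Proof.
elim/last_ind: v => [|v s IH]; first by rewrite cats0.
rewrite -rcons_cat size_rcons mulnS natrD mulrDl => uvs tx xu.
have uv : phi (u ++ v) <> None by rewrite -cats1 in uvs; exact: phi_prefix uvs.
have lv := enorm_wval v; have ls := enorm_gval s.
have {}IH : dev u t <-> dev (u ++ v) t by apply: IH => //; have := r_gt0; lra.
rewrite IH.
apply: dev_rcons uvs tx _ _; rewrite ?wval_rcons wval_cat !opprD !addrA.
  by have := enormD (x - wval u) (- wval v); rewrite enormN; have := r_gt0; lra.
have := enormD (x - wval u) (- wval v); rewrite enormN.
by have := enormD (x - wval u - wval v) (- gval s); rewrite enormN; lra.
Qed.

(** * Walks towards a point or a tile *)

Lemma gen_of_tile u t : dev u t -> 0 < enorm (pos P t - wval u) <= 3 * r ->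
  exists s, phi (rcons u s) <> None /\ wval (rcons u s) = pos P t.
Proof.
move=> ut; have [T [OT dT _]] := devP (dev_phi ut).
have Tt : T t by move: ut; rewrite dT => -[].
move: ut; rewrite /dev; case E : (phi u) => [m|//] /translate_tilesE mt ptu.
have H : (m, pos P t - wval u) \in patch_gens P K.
  apply/mem_set; split => //=; exists (translate t (- wval u)) => //.
  by rewrite (pos_translate hP _ OT Tt).
exists (SigSub H); split; last by rewrite wval_rcons addrC subrK.
by have [m' -> _] := (phi_rcons u (SigSub H)).1 E.
Qed.

(** Aim at the point [z] at distance [2 * r] towards [x]. A tile over [z] has its position within
    [r] of [z], hence between [r] and [3 * r] from the end of [u]: a legal letter. It gains at least
    [r] if [x] is farther than [3 * r], and otherwise leaves [x] within [3 * r]. *)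
Lemma step_towards u x k : phi u <> None -> enorm (x - wval u) <= (k + 3)%:R * r ->
  exists s, [/\ phi (rcons u s) <> None,
    enorm (x - wval (rcons u s)) <= (k.-1 + 3)%:R * r &
    enorm (x - wval u) <= K%:R * r -> enorm (x - wval (rcons u s)) <= K%:R * r].
Proof.
move=> u0 xu; have [z zu xz] := point_towards (wval u) x (2 * r) d_gt0.
have r2 : 0 <= 2 * r by have := r_gt0; lra.
rewrite (ger0_norm r2) in zu.
have [|t ut tz] := @dev_cover u z u0; first by rewrite zu; have := hKR; lra.
have zt := dev_dist ut tz.
have [|s [us sE]] := gen_of_tile ut.
  have := enorm_triangle (pos P t) z (wval u).
  have := enorm_triangle z (pos P t) (wval u).
  rewrite (enorm_distC (pos P t) z) zu => h1 h2.
  by have r0 := r_gt0; apply/andP; split; lra.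
have xs : enorm (x - pos P t) <= Num.max (3 * r) (enorm (x - wval u) - r).
  have := enorm_triangle z x (pos P t); rewrite xz le_max => h.
  have [h3|h3] := lerP (enorm (x - wval u)) (3 * r).
    apply/orP; left; suff : `|enorm (x - wval u) - 2 * r| <= 2 * r by lra.
    by rewrite ler_norml; apply/andP; split; have := enorm_ge0 (x - wval u); lra.
  by apply/orP; right; rewrite ger0_norm in h; lra.
exists s; rewrite sE; split=> //; last first.
  move=> xK; apply: (le_trans xs); rewrite ge_max; apply/andP; split;
    have := hKR; have := r_gt0; lra.
apply: (le_trans xs); rewrite ge_max natrD mulrDl.
have k0 : 0 <= k.-1%:R * r by rewrite mulr_ge0// ltW.
apply/andP; split; first by lra.
case: k xu {k0} => [|k] /=; rewrite natrD mulrDl; first by have := r_gt0; lra.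
by rewrite -natr1 mulrDl; lra.
Qed.

(** A step is possible even when [x] is already near, so the length can be prescribed exactly, which
    later guarantees nonempty words. A walk that starts within [K * r] of [x] stays so, hence keeps
    the tiles over [x]. *)
Lemma reach u x k : phi u <> None -> enorm (x - wval u) <= (k + 3)%:R * r ->
  exists v, [/\ size v = k, phi (u ++ v) <> None,
    enorm (x - wval (u ++ v)) <= 3 * r &
    enorm (x - wval u) <= K%:R * r -> forall t, t x -> dev u t <-> dev (u ++ v) t].
Proof.
elim: k u => [|k IH] u u0 xu; first by exists [::]; rewrite cats0.
have [s [us xs xK]] := step_towards u0 xu.
have [v [sv usv xv H]] := IH _ us xs.
exists (s :: v); rewrite -cat_rcons; split=> //=; first by rewrite sv.
by move=> xu' t tx; rewrite (dev_rcons us tx xu' (xK xu')); apply: H => //; exact: xK.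
Qed.

Lemma ends_near x : exists v, phi v <> None /\ enorm (x - wval v) <= 3 * r.
Proof.
have [k xk] : exists k, enorm (x - wval ([::] : word)) <= (k + 3)%:R * r.
  exists (Num.truncn (enorm x / r)).+1; rewrite wval_nil subr0 -ler_pdivrMr//.
  by apply: le_trans (ltW (truncnS_gt _)) _; rewrite ler_nat leq_addr.
by have [v [_ vW xv _]] := reach phi_nil xk; exists ([::] ++ v).
Qed.

(** For positive [k], a walk of [k - 1] letters comes within [3 * r] of the position with [t] still
    visible, and a last letter, if any is missing, lands on it exactly. *)
Lemma reach_tile u t k : (k <= K)%N -> dev u t ->
  enorm (pos P t - wval u) <= k%:R * r ->
  exists v, [/\ (size v <= k)%N, phi (u ++ v) <> None & wval (u ++ v) = pos P t].
Proof.
case: k => [|k] kK ut tu.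
  exists [::]; rewrite cats0; split=> //; first exact: dev_phi ut.
  apply/esym/eqP; rewrite -subr_eq0; apply/eqP/enorm_eq0/eqP.
  by rewrite eq_le enorm_ge0 andbT (le_trans tu)// mul0r.
have tu' : enorm (pos P t - wval u) <= (k + 3)%:R * r.
  by apply: (le_trans tu); rewrite ler_pM2r// ler_nat; lia.
have [v [sv uv tv H]] := reach (dev_phi ut) tu'.
have uvt : dev (u ++ v) t.
  apply/H => //; last exact: dev_pos_mem ut.
  by apply: (le_trans tu); rewrite ler_pM2r// ler_nat.
have [/enorm_eq0/eqP|n0] := eqVneq (enorm (pos P t - wval (u ++ v))) 0.
  by rewrite subr_eq0 => /eqP tE; exists v; rewrite sv.
have [|s [us sE]] := gen_of_tile uvt.
  by rewrite tv andbT lt_neqAle eq_sym n0 enorm_ge0.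
by exists (rcons v s); rewrite size_rcons sv -rcons_cat.
Qed.

(** * Links between words and the filling of short loops *)

Variables (L : nat) (hL : (2 * K + 14 <= L)%N).
Hypothesis phi_rel : forall u w w' v,
  (size w + size w' <= L)%N -> winit w = winit w' -> wval w = wval w' ->
  phi (u ++ w ++ v) <> None -> phi (u ++ w' ++ v) <> None ->
  phi (u ++ w ++ v) = phi (u ++ w' ++ v).

(* Equality of all continuations, rather than equivalence in the sense of the
   blueprint: rewriting steps may leave the support of [phi]. *)
Definition eqv u v := wval u = wval v /\ forall w, phi (u ++ w) = phi (v ++ w).

(** An oriented notion: links compose by [linked_trans], and two links leaving from the same word
    give one between their ends by [linked_fan]. *)
Definition linked u v k :=
  exists w, [/\ (size w <= k)%N, phi (u ++ w) <> None & eqv (u ++ w) v].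

Lemma eqv_sym u v : eqv u v -> eqv v u.
Proof. by move=> [uv H]; split. Qed.

Lemma eqv_trans u v w : eqv u v -> eqv v w -> eqv u w.
Proof. by move=> [uv H] [vw H']; split => [|z]; rewrite ?uv// H. Qed.

Lemma eqv_cat u v w : eqv u v -> eqv (u ++ w) (v ++ w).
Proof. by move=> [uv H]; split => [|z]; rewrite ?wval_cat ?uv// -!catA. Qed.

Lemma eqv_phi u v : eqv u v -> phi u = phi v.
Proof. by move=> [_ /(_ [::])]; rewrite !cats0. Qed.

Lemma eqv_dev u v : eqv u v -> dev u = dev v.
Proof. by move=> uv; rewrite /dev (eqv_phi uv) uv.1. Qed.

Lemma linked_phi u v k : linked u v k -> phi v <> None.
Proof. by move=> [w [_ + /eqv_phi <-]]. Qed.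

Lemma linked_eqvl u u' v k : eqv u u' -> linked u v k -> linked u' v k.
Proof.
move=> uu' [w [wk uw wv]]; have H := eqv_cat w uu'.
by exists w; split=> //; [rewrite -(eqv_phi H)|exact: eqv_trans (eqv_sym H) wv].
Qed.

Lemma linked_eqvr u v v' k : eqv v v' -> linked u v k -> linked u v' k.
Proof. by move=> vv' [w [wk uw wv]]; exists w; split=> //; exact: eqv_trans wv vv'. Qed.

Lemma linked_trans u v w k l : linked u v k -> linked v w l -> linked u w (k + l).
Proof.
move=> [y [yk uy yv]] /(linked_eqvl (eqv_sym yv)) [z [zl uyz zw]].
by exists (y ++ z); rewrite size_cat leq_add// catA.
Qed.

Lemma linked_dev u v k x t : linked u v k -> t x ->
  enorm (x - wval u) + (3 * k)%:R * r <= K%:R * r -> dev u t <-> dev v t.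
Proof.
move=> [w [wk uw wv]] tx xu; rewrite -(eqv_dev wv); apply: dev_cat tx _ => //.
by apply: le_trans xu; rewrite lerD2l ler_pM2r// ler_nat leq_mul2l.
Qed.

(** Being nonempty, [y] and [z] both start in the state [phi u], so they form a relation. Along a
    continuation the values agree by induction, so the next letter can be read after both words or
    after neither; in the first case the relation applies again. *)
Lemma rel_eqv u y z : phi (u ++ y) <> None -> phi (u ++ z) <> None ->
  y <> [::] -> z <> [::] -> (size y + size z <= L)%N ->
  wval (u ++ y) = wval (u ++ z) -> eqv (u ++ y) (u ++ z).
Proof.
move=> uy uz y0 z0 yz yzE; split=> //.
have wE : wval y = wval z by move: yzE; rewrite !wval_cat => /addrI.
have iE : winit y = winit z.
  case: y uy y0 {yz yzE wE} => // s y /phi_init uy _.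
  case: z uz z0 => // s' z /phi_init uz _.
  by rewrite /winit/= -uy.
elim/last_ind=> [|w s IH]; first rewrite !cats0 -(cats0 y) -(cats0 z).
  by apply: phi_rel; rewrite ?cats0.
have [us|us] := pselect (phi ((u ++ y) ++ w) = Some (patch_init s)).
  have [m Em _] := (phi_rcons _ _).1 us.
  have [m' Em' _] := (phi_rcons _ _).1 (etrans (esym IH) us).
  move: Em Em'; rewrite !rcons_cat -!catA => Em Em'.
  by apply: phi_rel; rewrite // ?Em ?Em'.
by rewrite -!rcons_cat (phi_rcons _ _).2// (phi_rcons _ _).2// -IH.
Qed.

(* The tile at the end of [u ++ z] is visible from every prefix of both words,
   so a path inside patches leads to it from the end of [u ++ y]; the resulting
   triangle based at [u] is short enough to be a relation. *)
Lemma fan u y z k : y <> [::] -> z <> [::] ->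
  phi (u ++ y) <> None -> phi (u ++ z) <> None -> (size y + k + size z <= L)%N ->
  (3 * size z + 3 * size z <= K)%N -> (3 * size z + 3 * size y <= K)%N -> (k <= K)%N ->
  enorm (wval (u ++ z) - wval (u ++ y)) <= k%:R * r -> linked (u ++ y) (u ++ z) k.
Proof.
move=> y0 z0 uy uz yzL zzK zyK kK d_yz.
have [_ [_ _ [t zt tE]]] := devP uz; have tp := dev_pos_mem zt.
have tu : enorm (pos P t - wval u) <= (3 * size z)%:R * r.
  by rewrite tE wval_cat [wval u + _]addrC addrK; exact: enorm_wval.
have ut : dev u t.
  apply/(dev_cat uz tp) => //; apply: le_trans (lerD tu (lexx _)) _.
  by rewrite -mulrDl -natrD ler_pM2r// ler_nat.
have yt : dev (u ++ y) t.
  apply/(dev_cat uy tp) => //; apply: le_trans (lerD tu (lexx _)) _.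
  by rewrite -mulrDl -natrD ler_pM2r// ler_nat.
have [|w [wk uw wE]] := @reach_tile _ _ k kK yt; first by rewrite tE.
exists w; split=> //; rewrite -catA; apply: rel_eqv; rewrite ?catA//.
- by case: (y) y0.
- by rewrite size_cat (leq_trans _ yzL)// leq_add2r leq_add2l.
- by rewrite wE.
Qed.

(** Links may be empty while [fan] asks for nonempty paths, so the last letter of [u] is prepended
    to both; hence the [2] and the [6] in the bounds. The new length [k] is governed by the distance
    of the ends and not by [i] and [j], so lengths do not accumulate in inductions. *)
Lemma linked_fan u a b i j k : u <> [::] -> linked u a i -> linked u b j ->
  (i + k + j + 2 <= L)%N -> (6 * j + 6 <= K)%N -> (3 * i + 3 * j + 6 <= K)%N ->
  (k <= K)%N -> enorm (wval b - wval a) <= k%:R * r -> linked a b k.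
Proof.
case/lastP: u => // u s _ [y [yi uy ya]] [z [zj uz zb]] ijL jK ijK kK d_ab.
apply: (linked_eqvl ya); apply: (linked_eqvr zb).
rewrite !cat_rcons in uy uz ya zb *; apply: fan => //=; [lia..|].
by rewrite zb.1 ya.1.
Qed.

Lemma linked_refl u k : phi u <> None -> linked u u k.
Proof. by move=> u0; exists [::]; rewrite cats0. Qed.

(* Continuation of [phi] along rays: [c x] is a word that ends near [x] and is
   obtained by following the segment from [0] to [x]. *)
Definition ray_words (s0 : patch_gens P K) (n : nat) (c : E -> word) :=
  [/\ forall x, enorm x <= n%:R * r ->
        [/\ c x <> [::], phi (c x) <> None & enorm (x - wval (c x)) <= 3 * r],
      forall x x', enorm x <= n%:R * r -> enorm x' <= n%:R * r ->
        enorm (x - x') <= 6 * r -> linked (c x) (c x') 12 &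
      linked (c 0) [:: s0] 6].

(** The word for [x] extends the one for [a *: x] by one letter. Scaling by [a] does not increase
    distances, so the inner words are linked by induction, and [linked_fan] closes the cell between
    two rays by a link whose length is again 12. *)
Lemma ray_words_exist s0 n : phi [:: s0] <> None -> exists c, ray_words s0 n c.
Proof.
move=> s00; elim: n => [|n [c [c_end c_link c0]]].
  exists (fun=> [:: s0]); split=> [x x0|x x' _ _ _|]; try exact: linked_refl.
  split=> //; have -> : x = 0.
    by apply: enorm_eq0; apply/eqP; rewrite eq_le enorm_ge0 andbT (le_trans x0)// mul0r.
  by rewrite sub0r enormN -[[:: s0]]/(rcons [::] s0) wval_rcons wval_nil add0r enorm_gval.
(* This ratio maps the ball of radius [n.+1%:R * r] into that of radius [n%:R * r] and moves its
   points by at most [r]. *)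
pose a : R := n%:R / n.+1%:R.
have n1 : (n.+1%:R : R) != 0 by rewrite pnatr_eq0.
have aE : a = 1 - n.+1%:R^-1.
  by apply: (mulIf n1); rewrite divfK// mulrBl mul1r mulVf// -natr1 addrK.
have a0 : 0 <= a by rewrite divr_ge0.
have a1 : a <= 1 by rewrite aE gerBl invr_ge0.
have small x : enorm x <= n.+1%:R * r -> enorm (a *: x) <= n%:R * r.
  move=> xn; rewrite enormZ ger0_norm// (le_trans (ler_wpM2l a0 xn))//.
  by rewrite mulrA divfK.
have close x : enorm x <= n.+1%:R * r -> enorm (x - a *: x) <= r.
  move=> xn; rewrite -{1}[x]scale1r -scalerBl aE opprB addrC subrK enormZ.
  rewrite ger0_norm ?invr_ge0// (le_trans (ler_wpM2l _ xn)) ?invr_ge0//.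
  by rewrite mulrA mulVf// mul1r.
have ex x : exists w, enorm x <= n.+1%:R * r ->
    [/\ w <> [::], linked (c (a *: x)) w 1 & enorm (x - wval w) <= 3 * r].
  have [xn|] := pselect (enorm x <= n.+1%:R * r); last by exists [::].
  have [cx cxW cxd] := c_end _ (small _ xn).
  (* One letter suffices, since [x] is within [r + 3 * r] of the end of [c (a *: x)]. *)
  have [|w [w1 ww wd _]] := @reach (c (a *: x)) x 1 cxW.
    by have := enorm_triangle (a *: x) x (wval (c (a *: x))); have := close _ xn; lra.
  exists (c (a *: x) ++ w) => _; split=> //; last by exists w; rewrite w1.
  by case: (c _) cx.
have [c' c'P] := choice ex; exists c'.
have c'_end x : enorm x <= n.+1%:R * r ->
    [/\ c' x <> [::], phi (c' x) <> None & enorm (x - wval (c' x)) <= 3 * r].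
  by move=> xn; have [? /linked_phi ? ?] := c'P x xn.
split=> // [x x' xn xn' xx'|].
  have [_ l1 d1] := c'P x xn; have [_ l2 d2] := c'P x' xn'.
  have [cx _ _] := c_end _ (small _ xn).
  have l3 : linked (c (a *: x)) (c (a *: x')) 12.
    apply: c_link; rewrite ?small// -scalerBr enormZ ger0_norm//.
    by rewrite (le_trans _ xx')// ler_piMl// enorm_ge0.
  (* The sides of the cell have lengths 1 and [12 + 1]; the ends are at most [3 * r + 6 * r + 3 * r]
     apart, whence the 12. *)
  apply: (linked_fan cx l1 (linked_trans l3 l2)); [clear -hK hL; lia..|].
  have := enorm_triangle x' (wval (c' x')) (wval (c' x)); have := enorm_triangle x x' (wval (c' x)).
  by rewrite (enorm_distC _ x') (enorm_distC x' x); lra.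
have z0 m : enorm (0 : E) <= m%:R * r by rewrite enorm0 mulr_ge0// ltW.
have [_ l1 d1] := c'P 0 (z0 _); rewrite scaler0 in l1.
have [cx _ _] := c_end 0 (z0 _).
apply: (linked_fan cx l1 c0); [clear -hK hL; lia..|].
have := enorm_gval s0; rewrite -[[:: s0]]/(rcons [::] s0) wval_rcons wval_nil add0r.
by have := enorm_triangle 0 (gval s0) (wval (c' 0)); rewrite subr0; lra.
Qed.

(** From the ray word at the end of [w], both [rcons w s] and its own ray word are reached by links
    of length 12, which [linked_fan] turns into one of length 3. The bound on [size w] keeps the
    ends in the ball where [c] is controlled. *)
Lemma linked_ray s0 n c w : phi [:: s0] <> None -> ray_words s0 n c ->
  w <> [::] -> phi w <> None -> (3 * size w <= n)%N -> linked (c (wval w)) w 3.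
Proof.
move=> s00 [c_end c_link c0]; elim/last_ind: w => // w s IH _ ws.
rewrite size_rcons => wn.
have rn k : (k <= n)%N -> k%:R * r <= n%:R * r by move=> kn; rewrite ler_pM2r// ler_nat.
have w_n : enorm (wval w) <= n%:R * r.
  by apply: (le_trans (enorm_wval w)); apply: rn; lia.
have ws_n : enorm (wval (rcons w s)) <= n%:R * r.
  by apply: (le_trans (enorm_wval _)); apply: rn; rewrite size_rcons.
have [cw _ _] := c_end _ w_n; have [_ _ d_ws] := c_end _ ws_n.
have l1 : linked (c (wval w)) (c (wval (rcons w s))) 12.
  apply: c_link => //; rewrite wval_rcons opprD addrA subrr sub0r enormN.
  by have := enorm_gval s; have := r_gt0; lra.
have {}IH : linked (c (wval w)) (rcons w s) 12.
  have [w0|w0] := pselect (w = [::]).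
    (* The induction does not cover the empty word; the path goes from [c 0] through [[:: s0]] to
       [[:: s]], at most 6 letters each time. *)
    rewrite w0 wval_nil /=; apply: (linked_trans c0) (_ : linked _ _ 6).
    rewrite w0 /= in ws; apply: (@fan [::] [:: s0] [:: s]) => //=; [clear -hK hL; lia..|].
    rewrite -[[:: s0]]/(rcons [::] s0) -[[:: s]]/(rcons [::] s) !wval_rcons wval_nil !add0r.
    by have := enormD (gval s) (- gval s0); rewrite enormN;
      have := enorm_gval s; have := enorm_gval s0; lra.
  have wW : phi w <> None by move: ws; rewrite -cats1; exact: phi_prefix.
  have [|y [yk yW ye]] := IH w0 wW; first by lia.
  exists (rcons y s); rewrite size_rcons -rcons_cat -!cats1; split; first by lia.
    by rewrite (eqv_phi (eqv_cat _ ye)) cats1.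
  exact: eqv_cat.
apply: (linked_fan cw l1 IH); [clear -hK hL; lia..|exact: d_ws].
Qed.

(** The ray word at the end of [u] is linked to [u] with length 3 and, through the ray word at the
    end of [v], to [v] with length 15. It ends within [6 * r] of [x], and [6 + 3 * 15 <= K], so
    tiles over [x] persist along both links. *)
Lemma dev_near u v x t : u <> [::] -> v <> [::] -> phi u <> None -> phi v <> None ->
  enorm (x - wval u) <= 3 * r -> enorm (x - wval v) <= 3 * r -> t x ->
  dev u t <-> dev v t.
Proof.
move=> u0 v0 uW vW xu xv tx.
have [s0 s00] : exists s0, phi [:: s0] <> None.
  by case: u u0 uW {xu} => // s u _ H; exists s; exact: (@phi_prefix [:: s] u).
pose n := (3 * (size u + size v))%N.
have [c cP] := ray_words_exist n s00.
have lu : linked (c (wval u)) u 3 by apply: (linked_ray s00 cP) => //; rewrite /n; lia.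
have lv : linked (c (wval v)) v 3 by apply: (linked_ray s00 cP) => //; rewrite /n; lia.
have [c_end c_link _] := cP.
have u_n : enorm (wval u) <= n%:R * r.
  by apply: (le_trans (enorm_wval u)); rewrite ler_pM2r// ler_nat /n; lia.
have v_n : enorm (wval v) <= n%:R * r.
  by apply: (le_trans (enorm_wval v)); rewrite ler_pM2r// ler_nat /n; lia.
have [_ _ du] := c_end _ u_n.
have dx := enorm_triangle (wval u) x (wval (c (wval u))).
have luv : linked (c (wval u)) v (12 + 3).
  apply: linked_trans lv; apply: c_link => //.
  by have := enorm_triangle x (wval u) (wval v); rewrite (enorm_distC _ x); lra.
have H := hKR; have r0 := r_gt0.
rewrite -(linked_dev lu tx); last by lra.
by rewrite -(linked_dev luv tx)//; lra.
Qed.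

(** Prolonging both words by exactly [K] letters towards [x] makes them nonempty and near [x]
    without changing the tiles over [x]. *)
Lemma dev_agree u v x t : phi u <> None -> phi v <> None -> t x ->
  enorm (x - wval u) <= K%:R * r -> enorm (x - wval v) <= K%:R * r ->
  dev u t <-> dev v t.
Proof.
move=> uW vW tx xu xv.
have far w : enorm (x - wval w) <= K%:R * r -> enorm (x - wval w) <= (K + 3)%:R * r.
  by move=> xw; apply: (le_trans xw); rewrite ler_pM2r// ler_nat leq_addr.
have [y [yK uy xuy uE]] := reach uW (far _ xu).
have [z [zK vz xvz vE]] := reach vW (far _ xv).
have ne w w' : size w' = K -> w ++ w' <> [::].
  by move=> w'K /(congr1 size); rewrite size_cat w'K /=; move: hK; lia.
by rewrite (uE xu t tx) (vE xv t tx); apply: dev_near xuy xvz tx => //; exact: ne.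
Qed.

(** * The glued tiling *)

Definition dev_tiling : set (set E) := [set t | exists u, dev u t].

(** The tile may stick out of the ball of its patch, so the walk aims at a point [x'] of [t] inside
    the ball; [x] is within [2 * r] of [x']. *)
Lemma dev_move u x t : dev u t -> t x ->
  exists v, dev v t /\ enorm (x - wval v) <= K%:R * r.
Proof.
move=> ut tx; have [T [_ dT _]] := devP (dev_phi ut).
have [_ [x' [tx' x'u]]] : meet_patch T (patch_ball P K (wval u)) t by rewrite -dT.
have [|v [_ uv x'v vE]] := @reach u x' K (dev_phi ut).
  by apply: (le_trans x'u); rewrite ler_pM2r// ler_nat leq_addr.
have uvt : dev (u ++ v) t by apply/vE.
exists (u ++ v); split=> //.
have := dev_dist ut tx; have := dev_dist ut tx'.
have := enorm_triangle (pos P t) x x'; have := enorm_triangle x' x (wval (u ++ v)).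
by rewrite (enorm_distC (pos P t)); have := hKR; have := r_gt0; lra.
Qed.

Lemma dev_meet_tiling u : phi u <> None ->
  dev u = meet_patch dev_tiling (patch_ball P K (wval u)).
Proof.
move=> uW; have [T [_ dT _]] := devP uW; apply/seteqP; split=> t.
  by move=> ut; split; [exists u|move: ut; rewrite dT => -[]].
move=> [[v vt] [x [tx xu]]]; have [w [wt xw]] := dev_move vt tx.
by apply/(@dev_agree u w x) => //; exact: dev_phi wt.
Qed.

(** Every property is local. In particular, two tiles whose interiors share a point are both seen
    from one word whose ball contains that point, and the patch there is part of a tiling. *)
Lemma dev_tiling_Omega : Omega P dev_tiling.
Proof.
split; last by move=> t [u ut]; exists (pos P t); exact: dev_pos_spec ut.
split; [split|].
- move=> t [u ut]; have [T [[[[tl _] _] _] dT _]] := devP (dev_phi ut).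
  by apply: tl; move: ut; rewrite dT => -[].
- move=> t t' [u ut] [u' ut'] tt'; apply/seteqP; split=> // x [xt xt'].
  have [v [vt xv]] := dev_move ut (interior_subset xt).
  have [v' [vt' xv']] := dev_move ut' (interior_subset xt').
  have {}vt' : dev v t'.
    by apply/(dev_agree (dev_phi vt) (dev_phi vt') (interior_subset xt')).
  have [T [[[[_ dj] _] _] dT _]] := devP (dev_phi vt).
  rewrite dT in vt vt'; have /seteqP[/(_ x) + _] := dj _ _ vt.1 vt'.1 tt'.
  by apply; split.
- apply/seteqP; split=> // x _.
  have [v [vW xv]] := ends_near x.
  have [|t vt tx] := @dev_cover _ x vW; first by have := hKR; have := r_gt0; lra.
  by exists t => //; exists v.
Qed.

Lemma dev_tiling_at u : phi u <> None -> Omega_o P (translate_tiles dev_tiling (- wval u)).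
Proof.
move=> uW; have [T [_ dT [t ut tE]]] := devP uW.
by apply: (Omega_o_at hP dev_tiling_Omega _ tE); exists u.
Qed.

Lemma dev_tiling_patch u : phi u <> None ->
  phi u = patch_at P K (translate_tiles dev_tiling (- wval u)).
Proof.
move=> uW.
have [m -> mE] := patch_atE K (dev_tiling_at uW).
have := dev_meet_tiling uW; rewrite /dev; case E : (phi u) uW => [m'|//] _ H.
congr Some; apply/val_inj; apply: etrans (esym mE).
have -> : patch_ball P K 0 = translate (patch_ball P K (wval u)) (- wval u).
  by rewrite (patch_ballE _ _ (wval u)) translateD subrr translate0.
by rewrite meet_patch_translate -H translate_tilesD subrr translate_tiles0.
Qed.

End development.

(** * Topologies *)

Section configuration_topology.
Variables (G : blueprint) (X : topologicalType).
Notation word := (seq (gen G)).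

Lemma nbhs_eval (phi : configurations G) (w : word) :
  nbhs phi [set psi : configurations G | psi w = phi w].
Proof.
have /cvg_sup/(_ w) : phi --> phi by exact: cvg_id.
apply; exists [set psi : configurations G | psi w = phi w]; split=> //.
by exists [set phi w]; first exact: discrete_open.
Qed.

(** In a product of discrete spaces, continuity amounts to local constancy of each coordinate. *)
Lemma configurations_continuous (f : X -> configurations G) :
  (forall x w, nbhs x [set x' | f x' w = f x w]) -> continuous f.
Proof.
move=> H x; apply/cvg_sup => w U [V] [[W oW <-]] Wf /filterS; apply.
by apply: filterS (H x w) => x' /= fE; rewrite /= fE.
Qed.

End configuration_topology.

Section tiling_topology.
Variables (R : realType) (d : nat) (P : set (set 'rV[R]_d)).
Notation X := (tiling_space P).
Implicit Types T : X.

(** The inequality is strict because the supremum of the agreement radii need not be attained. *)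
Lemma tdist_match (T1 T2 : set (set 'rV[R]_d)) (r : R) : 0 <= r ->
  tdist T1 T2 < 2 `^ (- r) -> match_in (cball 0 r) T1 T2.
Proof.
move=> r0; have := agreement_ge0 T1 T2.
rewrite /tdist; case E : agreement => [a| |] // a0; last by move=> _; exact: agreementy.
move=> ar; have {}ar : r < a.
  by rewrite ltNge; apply/negP => ra; move: ar; rewrite ltNge ler_powR ?lerN2 ?ler1n.
have : (r%:E < agreement T1 T2)%E by rewrite E lte_fin.
rewrite /agreement lt_max lte_fin [r < 0]ltNge r0 /= => /ereal_sup_gt[_ [s [s0 m] <-]].
by rewrite lte_fin => /ltW rs; exact: match_sub (cball_le rs) m.
Qed.

Lemma match_tdist (T1 T2 : set (set 'rV[R]_d)) (r : R) : 0 <= r ->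
  match_in (cball 0 r) T1 T2 -> tdist T1 T2 <= 2 `^ (- r).
Proof.
move=> r0 m; have : (r%:E <= agreement T1 T2)%E.
  by rewrite /agreement le_max ereal_sup_ubound ?orbT//; exists r.
rewrite /tdist; case: agreement => [a| |]; rewrite ?powR_ge0 ?leeNy_eq//.
by rewrite lee_fin => ra; rewrite ler_powR ?lerN2// ler1n.
Qed.

Lemma nbhs_match T (r : R) :
  nbhs T [set T' : X | match_in (cball 0 r) (set_val T) (set_val T')].
Proof.
apply/nbhs_ballP; exists (2 `^ (- `|r|)) => /=; first by rewrite powR_gt0.
move=> T'; rewrite ballEmdist /= => /(tdist_match (normr_ge0 _)).
by apply: match_sub; apply: cball_le; exact: ler_norm.
Qed.

Lemma nbhs_of_match T (U : set X) : nbhs T U ->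
  exists r : R, forall T' : X, match_in (cball 0 r) (set_val T) (set_val T') -> U T'.
Proof.
(* For this [n], [e^-1 < n < 2 ^ n]. *)
move=> /nbhs_ballP[e /= e0 eU]; pose n := (Num.truncn e^-1).+1.
exists n%:R => T' m; apply: eU; rewrite ballEmdist /=.
apply: le_lt_trans (match_tdist (ler0n _ _) m) _.
rewrite powRN powR_mulrn// -(invrK e) ltf_pV2 ?posrE ?exprn_gt0 ?invr_gt0//.
apply: lt_trans (truncnS_gt _) _; rewrite -natrX ltr_nat; exact: ltn_expl.
Qed.

End tiling_topology.

(** * The map Psi *)

Section Psi_models.
Variables (R : realType) (d : nat) (P : set (set 'rV[R]_d)).
Hypotheses (d_gt0 : (0 < d)%N) (hP : punctured_tiles P) (hO : Omega_o P !=set0).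
Variables (K L : nat) (K_gt0 : (0 < K)%N).
Notation G := (patch_blueprint d_gt0 hP hO L K_gt0).
Notation E := 'rV[R]_d.
Notation word := (seq (patch_gens P K)).
Notation r := (rho P).
Implicit Types (T : tiling_space P) (w : word).

Let r_gt0 : 0 < r := rho_gt0 hP d_gt0 hO.

Lemma PsiE T w : Psi K T w <> None ->
  Omega_o P (translate_tiles (set_val T) (- wval w)) /\
  Psi K T w = patch_at P K (translate_tiles (set_val T) (- wval w)).
Proof.
elim/last_ind: w => [_|w s _]; last by rewrite Psi_rcons /=; case: ifP => // /andP[_ /asboolP].
by rewrite Psi_nil wval_nil oppr0 translate_tiles0; split=> //; exact: set_valP.
Qed.

Lemma Psi_nil_neq T : Psi K T [::] <> None.
Proof. by rewrite Psi_nil; have [m ->] := patch_atE K (set_valP T). Qed.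

(** The vector of a generator is the position of a tile in its initial patch. Hence, once [s] can be
    read after [w], the shifted tiling has a tile at the origin and passes the membership test of
    [Psi]. *)
Lemma Psi_step T w (s : patch_gens P K) :
  (Psi K T w = Some (patch_init s) ->
    exists2 m, Psi K T (rcons w s) = Some m & patch_term s m) /\
  (Psi K T w <> Some (patch_init s) -> Psi K T (rcons w s) = None).
Proof.
rewrite Psi_rcons /=; split=> [ws|/eqP/negbTE -> //].
rewrite ws eqxx /=; have [|oT] := @PsiE T w; first by rewrite ws.
have [m -> mE] := patch_atE K oT; rewrite ws => -[sE].
have [_ [t st vE]] := set_valP s.
set T' := translate_tiles _ _ in oT mE.
have [T't _] : meet_patch T' (patch_ball P K 0) t by rewrite -mE -sE.
have oT's := Omega_o_at hP oT.1 T't (esym vE).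
have T'sE : translate_tiles T' (- gval s) = translate_tiles (set_val T) (- wval (rcons w s)).
  by rewrite translate_tilesD -opprD wval_rcons.
rewrite -[(set_val s).2]/(gval s) T'sE in oT's.
rewrite (asboolT oT's); have [m' -> m'E] := patch_atE K oT's; exists m' => //.
rewrite /patch_term /= m'E sE mE -T'sE (patch_ballE _ _ (gval s)); exact: match_translate.
Qed.

Lemma equivalent_wval (u v : word) : @equivalent G u v -> wval u = wval v.
Proof.
move=> [_ _]; elim=> //= [{}u {}v [_ _ [x [y [w [w' [[_ _ ww'] -> ->]]]]]]|a b c _ -> _ //].
by rewrite !wval_cat ww'.
Qed.

Lemma Psi_model T : models (Psi K T : configurations G).
Proof.
split; first by split; [exact: Psi_nil_neq|move=> w s; exact: Psi_step].
by move=> u v /PsiE[_ ->] /PsiE[_ ->] /equivalent_wval ->.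
Qed.

(** Equivalence only compares consistent words, so this is what lets the relations act on the
    support of a model. The prefix [u] generalizes the induction. *)
Lemma consistent_supp (phi : configurations G) (u w : word) :
  consistent_map phi -> phi (u ++ w) <> None -> @consistent G w.
Proof.
move=> [_ step]; elim: w u => // s w IH u usw.
have us := phi_init step usw; have [m Em sm] := (step u s).1 us.
rewrite -cat_rcons in usw; split; last exact: IH usw.
by case: w usw {IH} => // s' w /(phi_init step); rewrite Em => -[mE]; rewrite mE in sm.
Qed.

Hypotheses (hK : (117 <= K)%N) (hL : (2 * K + 14 <= L)%N).

Lemma Psi_surjective (phi : configurations G) :
  models phi -> exists T, (Psi K T : configurations G) = phi.
Proof.
move=> [phiC phiE]; have [phi0 step] := phiC.
have phi_rel u w w' v : (size w + size w' <= L)%N -> winit w = winit w' ->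
    wval w = wval w' -> phi (u ++ w ++ v) <> None -> phi (u ++ w' ++ v) <> None ->
    phi (u ++ w ++ v) = phi (u ++ w' ++ v).
  move=> sL iE vE W W'; apply: phiE => //.
  have C := @consistent_supp phi [::] _ phiC W.
  have C' := @consistent_supp phi [::] _ phiC W'.
  split=> //; apply: rst_step; split=> //; exists u, v, w, w'; split=> //.
have at_ u : phi u <> None -> Omega_o P (translate_tiles (dev_tiling phi) (- wval u)).
  exact: (dev_tiling_at d_gt0 hP r_gt0 hK phi0 step hL phi_rel).
have patchE u : phi u <> None ->
    phi u = patch_at P K (translate_tiles (dev_tiling phi) (- wval u)).
  exact: (dev_tiling_patch d_gt0 hP r_gt0 hK phi0 step hL phi_rel).
have oT := at_ _ phi0; rewrite wval_nil oppr0 translate_tiles0 in oT.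
(* Both maps extend along a letter in the same cases, and then both give the patch of the glued
   tiling at the new end. *)
exists (SigSub (mem_set oT)); apply/funext; elim/last_ind => [|w s IH].
  rewrite Psi_nil (patchE _ phi0).
  by rewrite wval_nil oppr0 translate_tiles0.
rewrite Psi_rcons /= IH; have [ws|ws] := eqVneq (phi w) (Some (patch_init s)).
  have [m Em _] := (step w s).1 ws.
  have ws0 : phi (rcons w s) <> None by rewrite Em.
  by rewrite (asboolT (at_ _ ws0)) /= (patchE _ ws0).
by rewrite (step w s).2//; exact/eqP.
Qed.

(** * Tilings on balls and values of [Psi] at finitely many words *)

Lemma patch_at_eq (T1 T2 : set (set E)) : Omega_o P T1 -> Omega_o P T2 ->
  patch_at P K T1 = patch_at P K T2 ->
  meet_patch T1 (patch_ball P K 0) = meet_patch T2 (patch_ball P K 0).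
Proof.
by move=> /(patch_atE K)[m -> <-] /(patch_atE K)[m' -> <-] [->].
Qed.

Lemma patch_ball_meet (T : set (set E)) v :
  translate_tiles (meet_patch (translate_tiles T (- v)) (patch_ball P K 0)) v =
  meet_patch T (patch_ball P K v).
Proof.
by rewrite -meet_patch_translate translate_tilesD addNr translate_tiles0 -patch_ballE.
Qed.

Lemma Psi_eq_match T T' w : Psi K T w <> None -> Psi K T' w = Psi K T w ->
  match_in (patch_ball P K (wval w)) (set_val T) (set_val T').
Proof.
move=> W WE; have [oT TE] := PsiE W; rewrite -WE in W; have [oT' T'E] := PsiE W.
have := patch_at_eq oT oT'; rewrite -TE -T'E WE => /(_ erefl) m.
by rewrite /match_in -patch_ball_meet m patch_ball_meet.
Qed.

(** The end of a word is within [3 * size w * r] of the origin, so the patch balls visited along [w]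
    lie in this ball. *)
Lemma match_Psi_eq T T' w :
  match_in (cball 0 ((3 * size w + K)%:R * r)) (set_val T) (set_val T') ->
  Psi K T' w = Psi K T w.
Proof.
have same v : match_in (patch_ball P K v) (set_val T) (set_val T') ->
    patch_at P K (translate_tiles (set_val T') (- v)) =
    patch_at P K (translate_tiles (set_val T) (- v)).
  move=> m; rewrite /patch_at; congr insub.
  have H S : meet_patch (translate_tiles S (- v)) (patch_ball P K 0) =
      translate_tiles (meet_patch S (patch_ball P K v)) (- v).
    rewrite -meet_patch_translate (patch_ballE _ _ v) translateD subrr.
    by rewrite translate0.
  by rewrite !H m.
elim/last_ind: w => [|w s IH] m.
  move: (same 0); rewrite oppr0 !translate_tiles0 !Psi_nil; apply.
  by move: m; rewrite muln0 add0n.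
have {}IH : Psi K T' w = Psi K T w.
  apply: IH; apply: match_sub m; apply: cball_le.
  by rewrite ler_pM2r ?r_gt0// ler_nat size_rcons leq_add2r leq_mul2l leqnSn.
have [ws|ws] := pselect (Psi K T w = Some (patch_init s)); last first.
  by rewrite !(Psi_step _ _ _).2// IH.
have [a Ea _] := (Psi_step T w s).1 ws; have [b Eb _] := (Psi_step T' w s).1 (etrans IH ws).
have [|_ ->] := @PsiE T (rcons w s); first by rewrite Ea.
have [|_ ->] := @PsiE T' (rcons w s); first by rewrite Eb.
apply: same; apply: match_sub m => x xw; rewrite /cball /= subr0.
have := enormD (x - wval (rcons w s)) (wval (rcons w s)); rewrite subrK => /le_trans; apply.
by rewrite natrD mulrDl addrC lerD// enorm_wval.
Qed.

(** Ends of words of the support come near every point; compactness of the closed ball selects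
    finitely many of them. This serves both injectivity and continuity of the inverse. *)
Lemma Psi_determines T (a : R) : exists (F : {fset E}) (w : E -> word),
  forall T', (forall x, x \in F -> Psi K T' (w x) = Psi K T (w x)) ->
  match_in (cball 0 a) (set_val T) (set_val T').
Proof.
have ex (x : E) : exists w, Psi K T w <> None /\ enorm (x - wval w) <= 3 * r.
  exact: (ends_near d_gt0 hP r_gt0 hK (@Psi_nil_neq T) (Psi_step T)).
have [w wP] := choice ex.
(* The radius exceeds [3 * r], so the open ball contains [x], and is at most [K%:R * r], so the
   patch at the end of [w x] determines the tiling there. *)
pose U x := (fun y => enorm (y - wval (w x))) @^-1` [set s | s < 4 * r].
have := @compact_cball0 R d a; rewrite compact_cover => /(_ E setT U)[||F _ FU].
- move=> x _; apply: open_comp; last exact: open_lt.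
  move=> y _; apply: (@continuous_comp _ _ _ (fun y : E => y - wval (w x)) (@enorm R d)).
    exact: sub_cst_continuous.
  exact: enorm_continuous.
- move=> x _; exists x => //; rewrite /U /=; have [_ +] := wP x.
  by have := r_gt0; lra.
exists F, w => T' FE; apply: match_in_bigcup (FU) _ => x xF.
have [W _] := wP x; apply: match_sub (Psi_eq_match W (FE _ xF)) => y /ltW yU.
apply: (le_trans yU); rewrite ler_pM2r ?r_gt0// (ler_nat R 4 K).
by apply: leq_trans hK.
Qed.

End Psi_models.

Lemma Psi_injective (R : realType) (d : nat) (P : set (set 'rV[R]_d)) (K : nat) :
  (0 < d)%N -> punctured_tiles P -> Omega_o P !=set0 -> (117 <= K)%N ->
  injective (Psi K : tiling_space P -> _).
Proof.
move=> d_gt0 hP hO hK T T' TT'; apply: tdist_positivity; apply/eqP.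
rewrite eq_le tdist_ge0 andbT -(tdistxx T).
apply/tdist_anti/agreement_mono => a [a0 _]; split=> //.
have [F [w]] := Psi_determines d_gt0 hP hO hK T a.
by apply => x _; rewrite TT'.
Qed.

Theorem proposition6p6 (R : realType) (d : nat) (P : set (set 'rV[R]_d))
    (d_gt0 : (0 < d)%N) (hP : punctured_tiles P)
    (hflc : finite_local_complexity P) (hO : Omega_o P !=set0)
    (K L : nat) (K_gt0 : (0 < K)%N)
    (hK : (117 <= K)%N) (hL : (2 * K + 14 <= L)%N) :
  homeomorphism_onto
    (Psi K : tiling_space P -> configurations (patch_blueprint d_gt0 hP hO L K_gt0))
    (@models (patch_blueprint d_gt0 hP hO L K_gt0)).
Proof.
have surj (phi : set_type (@models (patch_blueprint d_gt0 hP hO L K_gt0))) :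
    exists T : tiling_space P, Psi K T = set_val phi.
  by apply: (Psi_surjective hK hL); exact: set_valP.
have [g gP] := choice surj.
pose h (T : tiling_space P) := SigSub (mem_set (Psi_model d_gt0 hP hO L K_gt0 T)).
exists h => //; exists g; split.
- by move=> T; apply: (Psi_injective d_gt0 hP hO hK); rewrite gP.
- by move=> phi; apply/val_inj; exact: gP.
- apply: continuous_comp_initial; apply: configurations_continuous => T w.
  by apply: filterS (nbhs_match T _) => T'; exact: match_Psi_eq.
(* Models agreeing with [phi] at finitely many words have preimages that match [g phi] on the ball
   of radius [a]. *)
- move=> phi U /nbhs_of_match[a aU].
  have [F [w Fw]] := Psi_determines d_gt0 hP hO hK (g phi) a.
  pose V x := [set psi : configurations (patch_blueprint d_gt0 hP hO L K_gt0) |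
    psi (w x) = set_val phi (w x)].
  have VF : nbhs (set_val phi) (\bigcap_(x in [set` F]) V x).
    by apply: filter_bigI => x _; exact: nbhs_eval.
  have val_cont : continuous (set_val :
      set_type (@models (patch_blueprint d_gt0 hP hO L K_gt0)) -> configurations _).
    exact: initial_continuous.
  have : nbhs phi (set_val @^-1` \bigcap_(x in [set` F]) V x) by exact: val_cont.
  rewrite nbhs_simpl; apply: filterS => psi psiV.
  by apply/aU/Fw => x xF; rewrite !gP; exact: psiV.
Qed.
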